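(* Let $(M,g,J,F,\theta)$ be an LCAK manifold of real dimension $2n\ge 4$. Then the following are equivalent: 1) $(F,\theta)$ is of the first kind and $J$ is adapted to $(F,\theta)$; 2) the metric $g$ is a pluricanonical LCAK metric with a non-zero Lee form $\theta$.
   Context: An LCS (locally conformally symplectic) structure on $M$ is a pair $(F,\theta)$ with $F$ a non-degenerate $2$-form and $\theta$ a closed $1$-form (the Lee form) such that $dF=\theta\wedge F$. An LCAK (locally conformally almost Kähler) manifold $(M,g,J,F,\theta)$ is a manifold $M$ with an LCS structure $(F,\theta)$ and an almost complex structure $J$ (not necessarily integrable) such that $g:=F(\cdot,J\cdot)$ is a Riemannian metric; $g$ is then called an LCAK metric. $D$ is the Levi-Civita connection of $g$. First kind: $(F,\theta)$ is of the first kind if there is a vector field $U$ with $\mathcal{L}_UF=0$ and $\theta(U)=1$. Given such a $U$, let $V$ be the vector field defined by $\iota_VF=\theta$, let $\eta=-\iota_UF$ and $H=\ker\theta\cap\ker\eta$; then $TM=H\oplus\mathrm{Span}(U,V)$. An almost complex structure $J$ is adapted to the LCS structure of the first kind if (for such a $U$) it preserves this splitting, $J\theta=-\eta$ (equivalently $JV=U$), where $(J\alpha)(X)=-\alpha(JX)$ on $1$-forms, and $d\eta(\cdot,J\cdot)$ is a positive definite metric on $H$. Equivalently, $F(X,JY)=d\eta(X,JY)-(\theta\wedge\eta)(X,JY)$ is a Riemannian metric on $M$ for which the splitting is orthogonal and $U,V$ are orthonormal. Pluricanonical: let $T=\theta^\sharp$ be the $g$-dual of $\theta$ and let $N$ be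 the Nijenhuis tensor, $4N(X,Y)=[JX,JY]-[X,Y]-J[JX,Y]-J[X,JY]$. The LCAK metric $g$ is pluricanonical if the image of $N$ is $g$-orthogonal to $\mathrm{Span}(T,JT)$ and the $2$-tensor $(D\theta)(X,Y)=(D_X\theta)(Y)$ is $J$-anti-invariant, i.e. $(D\theta)(JX,JY)=-(D\theta)(X,Y)$ for all vector fields $X,Y$.
   Formalization: Condition 1) is read up to homothety: for some constant c>0, (cF,θ) is of the first kind and J is adapted to it (literal 1) forces |θ|=1, while 2) is invariant under constant rescaling of g); M is taken connected and non-empty. *)

(* Defs.v *)
From HB Require Import structures.
From mathcomp Require Import all_boot all_order all_algebra.
From mathcomp Require Import all_classical all_reals all_analysis.
From mathcomp Require Import ring.
Set Implicit Arguments.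
Unset Strict Implicit.
Unset Printing Implicit Defensive.
Import Order.TTheory GRing.Theory Num.Theory numFieldNormedType.Exports.
Local Open Scope classical_set_scope.
Local Open Scope ring_scope.

(* On an open set U: all iterated partial derivatives of f of order at most k
   exist and are continuous on U. *)
Fixpoint Ck (R : realType) (m k : nat) (U : set 'rV[R]_m) (f : 'rV[R]_m -> R)
    : Prop :=
  (forall x, U x -> {for x, continuous f}) /\
  (if k is k'.+1 then
     forall i : 'I_m, let e := delta_mx 0 i : 'rV[R]_m in
       (forall x, U x -> derivable f x e) /\ Ck k' U (fun x => 'D_e f x)
   else True).

Record chart (R : realType) (m : nat) (M : topologicalType) := Chart {
  chart_dom : set M;
  chart_map : M -> 'rV[R]_m;
  chart_inv : 'rV[R]_m -> M;
  chart_dom_open : open chart_dom;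
  chart_cod_open : open (chart_map @` chart_dom);
  chart_mapK : {in chart_dom, cancel chart_map chart_inv};
  chart_map_cont : {within chart_dom, continuous chart_map};
  chart_inv_cont : {within chart_map @` chart_dom, continuous chart_inv}
}.

Definition chart_cod (R : realType) (m : nat) (M : topologicalType)
    (a : chart R m M) : set 'rV[R]_m :=
  chart_map a @` chart_dom a.

Definition smooth_transition (R : realType) (m : nat) (M : topologicalType)
    (a b : chart R m M) : Prop :=
  forall (j : 'I_m) (k : nat),
    Ck k (chart_map a @` (chart_dom a `&` chart_dom b))
      (fun x => chart_map b (chart_inv a x) 0 j).

(* The atlas need not be maximal. *)
Record manifold (R : realType) (m : nat) := Manifold {
  mcarrier :> topologicalType;
  atlas : set (chart R m mcarrier);
  atlas_cover : forall p : mcarrier, exists2 a, atlas a & chart_dom a p;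
  atlas_smooth : forall a b, atlas a -> atlas b -> smooth_transition a b;
  manifold_hausdorff : hausdorff_space mcarrier;
  manifold_second_countable : @second_countable mcarrier
}.

Definition smooth (R : realType) (m : nat) (M : manifold R m) (f : M -> R)
    : Prop :=
  forall a, @atlas R m M a -> forall k, Ck k (chart_cod a) (f \o chart_inv a).

Section CkTheory.
Context (R : realType) (m : nat) (U : set 'rV[R]_m) (Uo : open U).
Implicit Types f g : 'rV[R]_m -> R.

Lemma near_open_eq f g x : {in U, f =1 g} -> U x -> {near x, f =1 g}.
Proof.
move=> fg Ux; near=> y; apply: fg; rewrite inE.
by near: y; exact: open_nbhs_nbhs.
Unshelve. all: by end_near. Qed.

Lemma Ck_ext k f g : {in U, f =1 g} -> Ck k U f -> Ck k U g.
Proof.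
elim: k f g => [|k IH] f g fg [fc fd].
all: have gc x : U x -> {for x, continuous g}.
all: try (move=> Ux; rewrite /prop_for /continuous_at -(fg x) ?inE//;
  exact: cvg_trans (near_eq_cvg (near_open_eq fg Ux)) (fc x Ux)).
  by split.
split=> // i; have [fdi fk] := fd i; split=> [x Ux|].
  exact: near_eq_derivable (near_open_eq fg Ux) (fdi x Ux).
apply: IH fk => x; rewrite inE => Ux.
by apply: near_eq_derive; exact: near_open_eq.
Qed.

Lemma CkS k f : Ck k.+1 U f -> Ck k U f.
Proof.
elim: k f => [|k IH] f [fc fd]; split=> // i.
by have [? ?] := fd i; split=> //; exact: IH.
Qed.

Lemma Ck_cst k (c : R) : Ck k U (fun=> c).
Proof.
elim: k c => [|k IH] c; split=> //.
- by move=> x _; exact: cst_continuous.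
- by move=> x _; exact: cst_continuous.
move=> i; split=> [x _|]; first exact: derivable_cst.
by apply: Ck_ext (IH 0) => x _; rewrite derive_cst.
Qed.

Lemma CkD k f g : Ck k U f -> Ck k U g -> Ck k U (fun x => f x + g x).
Proof.
elim: k f g => [|k IH] f g [fc fd] [gc gd]; split=> //.
- by move=> x Ux; exact: (continuousD (fc x Ux) (gc x Ux)).
- by move=> x Ux; exact: (continuousD (fc x Ux) (gc x Ux)).
move=> i; have [fi fk] := fd i; have [gi gk] := gd i; split=> [x Ux|].
  by apply: derivableD; [exact: fi|exact: gi].
apply: Ck_ext (IH _ _ fk gk) => x; rewrite inE => Ux.
by rewrite -deriveD//; [exact: fi|exact: gi].
Qed.

Lemma CkM k f g : Ck k U f -> Ck k U g -> Ck k U (fun x => f x * g x).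
Proof.
elim: k f g => [|k IH] f g Cf Cg; have [fc fd] := Cf; have [gc gd] := Cg.
  by split=> // x Ux; exact: (continuousM (fc x Ux) (gc x Ux)).
split=> [x Ux|i]; first exact: (continuousM (fc x Ux) (gc x Ux)).
have [fi fk] := fd i; have [gi gk] := gd i; split=> [x Ux|].
  by apply: derivableM; [exact: fi|exact: gi].
apply: Ck_ext (CkD (IH _ _ (CkS Cf) gk) (IH _ _ (CkS Cg) fk)) => x.
by rewrite inE => Ux; rewrite deriveM//; [exact: fi|exact: gi].
Qed.

End CkTheory.

Section SmoothFunctions.
Context (R : realType) (m : nat) (M : manifold R m).

Definition smooth_pred : {pred M -> R} := [pred f | `[< smooth f >]].

Fact smooth_subring : subring_closed smooth_pred.
Proof.
split=> [|f g /asboolP Sf /asboolP Sg|f g /asboolP Sf /asboolP Sg];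
  apply/asboolP => a Aa k; have Uo : open (chart_cod a) by exact: (@chart_cod_open _ _ _ a).
- exact: Ck_cst.
- have Sg' : Ck k (chart_cod a) (fun x => -1 * (g \o chart_inv a) x).
    by apply: CkM => //; [exact: Ck_cst|exact: Sg].
  apply: Ck_ext (CkD Uo (Sf a Aa k) Sg') => //= x _.
  by rewrite mulN1r.
- by apply: Ck_ext (CkM Uo (Sf a Aa k) (Sg a Aa k)).
Qed.

Record Cinf := MkCinf { Cfun :> M -> R; CfunP : Cfun \in smooth_pred }.

HB.instance Definition _ := [isSub for Cfun].
HB.instance Definition _ := [Choice of Cinf by <:].
HB.instance Definition _ :=
  GRing.SubChoice_isSubComPzRing.Build (M -> R) smooth_pred Cinf smooth_subring.

Fact cstC_subproof (c : R) : (fun _ : M => c) \in smooth_pred.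
Proof. by apply/asboolP => a Aa k; apply: Ck_cst; exact: chart_cod_open. Qed.

Definition cstC (c : R) : Cinf := MkCinf (cstC_subproof c).

Definition derivation (X : Cinf -> Cinf) : Prop :=
  [/\ forall f g, X (f + g) = X f + X g,
      forall (c : R) f, X (cstC c * f) = cstC c * X f
    & forall f g, X (f * g) = f * X g + X f * g].

End SmoothFunctions.

(* Smooth vector fields are derivations of the algebra of smooth functions;
   smooth tensor fields are maps on vector fields that are multilinear over
   that algebra. *)
Record vfield (R : realType) (m : nat) (M : manifold R m) := VField {
  vfun :> Cinf M -> Cinf M;
  vfunP : derivation vfun
}.

Section VectorFields.
Context (R : realType) (m : nat) (M : manifold R m).
Local Notation C := (Cinf M).
Local Notation VF := (vfield M).

HB.instance Definition _ := gen_eqMixin VF.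
HB.instance Definition _ := gen_choiceMixin VF.

Lemma vfieldP (X Y : VF) : (forall f, X f = Y f) -> X = Y.
Proof.
move: X Y => [X Xd] [Y Yd] /= /funext XY.
by subst Y; congr VField; exact: Prop_irrelevance.
Qed.

Lemma vfD (X : VF) f g : X (f + g) = X f + X g.
Proof. by have [] := vfunP X. Qed.

Lemma vfZ (X : VF) c f : X (cstC M c * f) = cstC M c * X f.
Proof. by have [] := vfunP X. Qed.

Lemma vfM (X : VF) f g : X (f * g) = f * X g + X f * g.
Proof. by have [] := vfunP X. Qed.

Lemma vf0 (X : VF) : X 0 = 0.
Proof. by apply: (addrI (X 0)); rewrite -vfD !addr0. Qed.

Lemma vfN (X : VF) f : X (- f) = - X f.
Proof. by apply: (addrI (X f)); rewrite -vfD !subrr vf0. Qed.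

Fact vzero_subproof : derivation (fun _ : C => 0 : C).
Proof. by split=> *; ring. Qed.
Definition vzero : VF := VField vzero_subproof.

Fact vadd_subproof (X Y : VF) : derivation (fun f => X f + Y f).
Proof. by split=> *; rewrite ?vfD ?vfZ ?vfM; ring. Qed.
Definition vadd X Y : VF := VField (vadd_subproof X Y).

Fact vopp_subproof (X : VF) : derivation (fun f => - X f).
Proof. by split=> *; rewrite ?vfD ?vfZ ?vfM; ring. Qed.
Definition vopp X : VF := VField (vopp_subproof X).

Fact vscale_subproof (h : C) (X : VF) : derivation (fun f => h * X f).
Proof. by split=> *; rewrite ?vfD ?vfZ ?vfM; ring. Qed.
Definition vscale h X : VF := VField (vscale_subproof h X).

Fact vaddA : associative vadd.
Proof. by move=> X Y Z; apply: vfieldP => f /=; rewrite addrA. Qed.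
Fact vaddC : commutative vadd.
Proof. by move=> X Y; apply: vfieldP => f /=; rewrite addrC. Qed.
Fact vadd0 : left_id vzero vadd.
Proof. by move=> X; apply: vfieldP => f /=; rewrite add0r. Qed.
Fact vaddN : left_inverse vzero vopp vadd.
Proof. by move=> X; apply: vfieldP => f /=; rewrite addNr. Qed.
HB.instance Definition _ := GRing.isZmodule.Build VF vaddA vaddC vadd0 vaddN.

Fact vscaleA f g X : vscale f (vscale g X) = vscale (f * g) X.
Proof. by apply: vfieldP => h /=; rewrite mulrA. Qed.
Fact vscale1 : left_id 1 vscale.
Proof. by move=> X; apply: vfieldP => f /=; rewrite mul1r. Qed.
Fact vscaleDr : right_distributive vscale +%R.
Proof. by move=> f X Y; apply: vfieldP => h /=; rewrite mulrDr. Qed.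
Fact vscaleDl X : {morph vscale^~ X : f g / f + g}.
Proof. by move=> f g; apply: vfieldP => h /=; rewrite mulrDl. Qed.
HB.instance Definition _ :=
  GRing.Zmodule_isLmodule.Build C VF vscaleA vscale1 vscaleDr vscaleDl.

Fact bracket_subproof (X Y : VF) : derivation (fun f => X (Y f) - Y (X f)).
Proof. by split=> *; rewrite ?(vfD, vfZ, vfM); ring. Qed.
Definition bracket (X Y : VF) : VF := VField (bracket_subproof X Y).

End VectorFields.

Section Geometry.
Context (R : realType) (m : nat) (M : manifold R m).
Local Notation C := (Cinf M).
Local Notation VF := (vfield M).
Local Notation "[| X , Y |]" := (bracket X Y).

Implicit Types (X Y Z U V T : VF) (F g : VF -> VF -> C) (theta : {scalar VF})
  (J : {linear VF -> VF}).

Definition vanishes_at (p : M) X : Prop := forall f : C, X f p = 0.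

Definition tensor2 (B : VF -> VF -> C) : Prop :=
  (forall f X Y Z, B (f *: X + Y) Z = f * B X Z + B Y Z) /\
  (forall f X Y Z, B Z (f *: X + Y) = f * B Z X + B Z Y).

Definition form2 F : Prop := tensor2 F /\ forall X, F X X = 0.

(* Every tangent vector of M extends to a vector field, so pointwise
   conditions can be tested on the values at p of vector fields. *)
Definition nondegenerate F : Prop :=
  forall p X, (forall Y, F X Y p = 0) -> vanishes_at p X.

Definition riemannian g : Prop :=
  [/\ tensor2 g, forall X Y, g X Y = g Y X
    & forall p X, ~ vanishes_at p X -> 0 < g X X p].

Definition d1 (alpha : VF -> C) X Y : C :=
  X (alpha Y) - Y (alpha X) - alpha [|X, Y|].

Definition d2 F X Y Z : C :=
  X (F Y Z) - Y (F X Z) + Z (F X Y)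
  - F [|X, Y|] Z + F [|X, Z|] Y - F [|Y, Z|] X.

Definition wedge12 (alpha : VF -> C) F X Y Z : C :=
  alpha X * F Y Z + alpha Y * F Z X + alpha Z * F X Y.

Definition lie_form2 U F X Y : C :=
  U (F X Y) - F [|U, X|] Y - F X [|U, Y|].

Definition LCS F theta : Prop :=
  [/\ form2 F, nondegenerate F, forall X Y, d1 theta X Y = 0
    & forall X Y Z, d2 F X Y Z = wedge12 theta F X Y Z].

Definition almost_complex J : Prop := forall X, J (J X) = - X.

Definition LCAK g J F theta : Prop :=
  [/\ LCS F theta, almost_complex J, forall X Y, g X Y = F X (J Y)
    & riemannian g].

Record levi_civita g (D : VF -> VF -> VF) : Prop := LeviCivita {
  lc_linearl : forall f X Y Z, D (f *: X + Y) Z = f *: D X Z + D Y Z;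
  lc_additive : forall X Y Z, D X (Y + Z) = D X Y + D X Z;
  lc_leibniz : forall f X Y, D X (f *: Y) = X f *: Y + f *: D X Y;
  lc_torsionfree : forall X Y, D X Y - D Y X = [|X, Y|];
  lc_metric : forall X Y Z, X (g Y Z) = g (D X Y) Z + g Y (D X Z)
}.

Definition first_kind_field F theta U : Prop :=
  (forall X Y, lie_form2 U F X Y = 0) /\ theta U = 1.

Definition first_kind F theta : Prop := exists U, first_kind_field F theta U.

Section Splitting.
Variables (theta eta : VF -> C) (U V : VF).

Definition in_H (p : M) X : Prop := theta X p = 0 /\ eta X p = 0.

Definition in_span (p : M) X : Prop :=
  exists a b : R, vanishes_at p (X - cstC M a *: U - cstC M b *: V).

End Splitting.

Definition adapted J F theta : Prop :=
  exists U V, [/\ first_kind_field F theta U, forall X, F V X = theta X &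
    let eta X := - F U X in
    let H := in_H theta eta in
    [/\ (forall p X, H p X -> H p (J X)) /\
        (forall p X, in_span U V p X -> in_span U V p (J X)),
        (* J theta = - eta *)
        forall X, - theta (J X) = - eta X,
        forall p X Y, H p X -> H p Y -> d1 eta X (J Y) p = d1 eta Y (J X) p
      & forall p X, H p X -> ~ vanishes_at p X -> 0 < d1 eta X (J X) p]].

Definition nijenhuis J X Y : VF :=
  cstC M 4^-1 *: ([|J X, J Y|] - [|X, Y|] - J [|J X, Y|] - J [|X, J Y|]).

Definition Dform1 (D : VF -> VF -> VF) (alpha : VF -> C) X Y : C :=
  X (alpha Y) - alpha (D X Y).

Definition pluricanonical g J theta (D : VF -> VF -> VF) : Prop :=
  exists T, [/\ forall X, g T X = theta X,
    forall X Y, g (nijenhuis J X Y) T = 0 /\ g (nijenhuis J X Y) (J T) = 0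
    & forall X Y, Dform1 D theta (J X) (J Y) = - Dform1 D theta X Y].

(* adapted J F theta forces g(V,V) = theta(U) = 1, so |theta|_g = 1 for
   g = F(.,J.), whereas pluricanonicity does not change when F and g are
   multiplied by a constant c > 0, which divides |theta|_g ^ 2 by c. *)
Definition scale_form2 (c : R) F X Y : C := cstC M c * F X Y.

End Geometry.

(* Main.v *)
(* Let T be the g-dual of theta.  Using only dF = theta /\ F and d theta = 0 one has
     4 g(N(X,Y), JT) = (L_T F)(X,Y) - (L_T F)(JX,JY),
     (L_T F)(X,Y) + (L_T F)(JX,JY) = 2 ((D theta)(JX,Y) - (D theta)(X,JY)).
   As N(JX,Y) = - J N(X,Y), the metric is pluricanonical if and only if L_T F = 0.
   In that case L_T dF = 0 gives d(theta(T)) /\ F = 0, so that theta(T) = |T|^2 is a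
   constant c, since dim M >= 4 and M is connected; c > 0 when theta <> 0.  After
   rescaling F by c the field U = T / c shows that the structure is of the first kind,
   and Cartan's formula gives d eta = c F + theta /\ eta with eta = theta o J, whence J
   is adapted.  Conversely, for an adapted J the field c U is dual to theta.

   Vector fields being derivations of the algebra of smooth functions, pointwise
   arguments rely on bump functions (fields with prescribed values at a point) and on
   Hadamard's lemma (a derivation is determined by its values on coordinates). *)
Require Import Defs.
From HB Require Import structures.
From mathcomp Require Import all_boot all_order all_algebra.
From mathcomp Require Import all_classical all_reals all_analysis.
From mathcomp Require Import ring.
Set Implicit Arguments.
Unset Strict Implicit.
Unset Printing Implicit Defensive.
Import Order.TTheory GRing.Theory Num.Theory numFieldNormedType.Exports.
Local Open Scope classical_set_scope.
Local Open Scope ring_scope.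

(** * Differentiation in several variables *)

Section LineDerivative.
Context (R : realType) (V : normedModType R).
Implicit Types (f : V -> R) (y e : V).

Lemma is_derive_line f y e s : derivable f (s *: e + y) e ->
  is_derive s 1 (fun t => f (t *: e + y)) ('D_e f (s *: e + y)).
Proof.
move=> df; set phi := fun t => f (t *: e + y).
have E : (fun h : R => h^-1 *: ((phi \o shift s) (h *: 1) - phi s)) =
    (fun h : R => h^-1 *: ((f \o shift (s *: e + y)) (h *: e) - f (s *: e + y))).
  by apply/funext => h; rewrite /phi /= [h *: 1]mulr1 scalerDl addrA.
by split; [rewrite /derivable E|rewrite /derive E].
Qed.

(** The absolute values let the step [t] have either sign; the proof splits on it because
    [MVT_segment] asks for ordered endpoints. *)
Lemma MVT_line f y e t :
  (forall s, `|s| <= `|t| -> derivable f (s *: e + y) e) ->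
  exists2 s, `|s| <= `|t| & f (t *: e + y) - f y = t * 'D_e f (s *: e + y).
Proof.
move=> df; set phi := fun s => f (s *: e + y).
have phi0 : f y = phi 0 by rewrite /phi scale0r add0r.
rewrite phi0 -/(phi t); have [t0|t0] := leP 0 t.
- have dphi s : s \in `[0, t] -> is_derive s 1 phi ('D_e f (s *: e + y)).
    by rewrite in_itv/= => /andP[s0 st]; apply/is_derive_line/df; rewrite !ger0_norm.
  have [|s /andP[s0 st] ->] := MVT_segment t0 (fun s si => dphi s (subset_itv_oo_cc si)).
    by apply: derivable_within_continuous => s /dphi[].
  rewrite subr0 mulrC; exists s => //.
  by move: s0 st; rewrite !bnd_simp => ? ?; rewrite !ger0_norm.
have dphi s : s \in `[t, 0] -> is_derive s 1 phi ('D_e f (s *: e + y)).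
  rewrite in_itv/= => /andP[s0 st]; apply/is_derive_line/df.
  by rewrite !ler0_norm ?lerN2 ?(ltW t0).
have [|s /andP[s0 st]] := MVT_segment (ltW t0) (fun s si => dphi s (subset_itv_oo_cc si)).
  by apply: derivable_within_continuous => s /dphi[].
rewrite sub0r => eqs; exists s; last by rewrite -opprB eqs mulrN opprK mulrC.
by move: s0 st; rewrite !bnd_simp => ? ?; rewrite !ler0_norm ?lerN2 ?(ltW t0).
Qed.

End LineDerivative.

(** * Continuous partial derivatives imply differentiability *)

Section C1.
Context (R : realType) (m : nat).
Implicit Types (f : 'rV[R]_m -> R) (c : 'I_m -> R).
Local Notation e_ i := (delta_mx 0 i : 'rV[R]_m).

Definition coordsum c (h : 'rV[R]_m) : R := \sum_i h 0 i * c i.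

Fact coordsum_linear c : linear (coordsum c).
Proof.
move=> a u v; rewrite /coordsum scaler_sumr -big_split/=; apply: eq_bigr => i _.
by rewrite !mxE mulrDl -mulrA.
Qed.
HB.instance Definition _ c :=
  GRing.isLinear.Build R 'rV[R]_m R _ (coordsum c) (coordsum_linear c).

Lemma coord_norm (h : 'rV[R]_m) i : `|h 0 i| <= `|h|.
Proof.
rewrite [leRHS]/Num.Def.normr/= mx_normrE.
exact: (le_bigmax _ (fun i => `|h i.1 i.2|) (0, i)).
Qed.

Lemma norm_delta_le i : `|e_ i| <= 1.
Proof.
rewrite [leLHS]/Num.Def.normr/= mx_normrE; apply: bigmax_le => // -[j k] _ /=.
by rewrite !mxE; case: (_ && _); rewrite ?normr1 ?normr0.
Qed.

Lemma coordsum_continuous c : continuous (coordsum c).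
Proof.
move=> x; apply: differentiable_continuous.
have -> : coordsum c = \sum_i (fun h : 'rV[R]_m => c i *: h 0 i).
  by apply/funext => h; rewrite fct_sumE; apply: eq_bigr => i _; rewrite mulrC.
apply: differentiable_sum => i; apply: differentiableZ; exact: differentiable_coord.
Qed.

(** The vertices of a path from [0] to [h] along the axes: consecutive truncations differ in one
    coordinate, where the mean value theorem in one variable applies. *)
Definition trunc k (h : 'rV[R]_m) : 'rV[R]_m := \row_j (if (j < k)%N then h 0 j else 0).

Lemma truncS k (km : (k < m)%N) h :
  trunc k.+1 h = h 0 (Ordinal km) *: e_ (Ordinal km) + trunc k h.
Proof.
apply/rowP => j; rewrite !mxE/= ltnS leq_eqVlt.
have [->|jk] := eqVneq j (Ordinal km); first by rewrite eqxx/= ltnn mulr1 addr0.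
by rewrite -(inj_eq val_inj) /= in jk; rewrite (negPf jk)/= mulr0 add0r.
Qed.

Lemma norm_trunc k h : `|trunc k h| <= `|h|.
Proof.
rewrite [leLHS]/Num.Def.normr/= mx_normrE; apply: bigmax_le => // -[i j] _ /=.
by rewrite !mxE; case: ifP => _; rewrite ?normr0 ?normr_ge0 ?coord_norm.
Qed.

Lemma C1_remainder f x :
  (\forall y \near x, forall i, derivable f y (e_ i)) ->
  (forall i, {for x, continuous (fun y => 'D_(e_ i) f y)}) ->
  f \o shift x = cst (f x) + coordsum (fun i => 'D_(e_ i) f x) +o_ 0 id.
Proof.
move=> df cf; apply/eqaddoP => eps eps0 /=.
(* Each of the [m] edges of the path costs at most [d * |h|]; dividing by [m.+1] also covers
   [m = 0]. *)
pose d := eps / m.+1%:R; have d0 : 0 < d by rewrite divr_gt0.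
have : \forall y \near x, (forall i, derivable f y (e_ i)) /\
    (forall i, `|'D_(e_ i) f x - 'D_(e_ i) f y| < d).
  apply: filterS2 _ df _ => [y d1 d2|]; first by split; [exact: d1|exact: d2].
  apply: (@filter_forall _ _ _ _ (nbhs_filter x)) => i.
  by have /cvgrPdist_lt := cf i; exact.
case/nbhs_ballP => r /= r0; rewrite -ball_normE => br.
near=> h.
(* Half the radius: a point on an edge is [x] plus two displacements of norm at most [|h|]. *)
have hr : `|h| < r / 2 by near: h; apply: (@nbhs0_lt _ 'rV[R]_m); rewrite divr_gt0.
have step k : (k <= m)%N ->
  `|f (trunc k h + x) - f x - \sum_(i < m | (i < k)%N) h 0 i * 'D_(e_ i) f x| <= d * `|h| *+ k.
  elim: k => [_|k IH km].
    rewrite big1 ?subr0; last by move=> i; rewrite ltn0.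
    have -> : trunc 0 h = 0 by apply/rowP => j; rewrite !mxE.
    by rewrite add0r subrr normr0 mulr0n.
  pose o := Ordinal km.
  have inb s : `|s| <= `|h 0 o| -> `|x - (s *: e_ o + (trunc k h + x))| < r.
    move=> sh; rewrite addrA opprD addrCA subrr addr0 normrN.
    have se : `|s *: e_ o| <= `|h|.
      rewrite normrZ; apply: le_trans (_ : `|s| * 1 <= _).
        by apply: ler_wpM2l => //; exact: norm_delta_le.
      by rewrite mulr1 (le_trans sh) ?coord_norm.
    apply: le_lt_trans (ler_normD _ _) _; rewrite (splitr r).
    by rewrite ltrD// (le_lt_trans _ hr)// norm_trunc.
  have [s sh mvt] := @MVT_line _ _ f (trunc k h + x) (e_ o) (h 0 o)
     (fun s sh => (br _ (inb s sh)).1 o).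
  rewrite (bigD1 o) /=; last by rewrite leqnn.
  rewrite (eq_bigl (fun i : 'I_m => (i < k)%N)); last first.
    move=> i /=; rewrite -(inj_eq val_inj)/= ltnS [(i <= k)%N]leq_eqVlt.
    by case: (ltngtP i k).
  move/eqP: mvt; rewrite subr_eq => /eqP mvt.
  have -> : trunc k.+1 h + x = h 0 o *: e_ o + (trunc k h + x) by rewrite (truncS km) addrA.
  rewrite mvt mulrSr.
  set S := \sum_(_ < _ | _) _ in IH *; set A := f _ in IH *.
  set z := s *: e_ o + (trunc k h + x).
  have -> : h 0 o * 'D_(e_ o) f z + A - f x - (h 0 o * 'D_(e_ o) f x + S) =
    (A - f x - S) - h 0 o * ('D_(e_ o) f x - 'D_(e_ o) f z) by ring.
  apply: le_trans (ler_normB _ _) _; apply: lerD; first exact/IH/ltnW.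
  rewrite normrM mulrC; apply: ler_pM => //; last exact: coord_norm.
  by apply/ltW; exact: (br _ (inb s sh)).2.
have := step m (leqnn m); rewrite (eq_bigl xpredT); last by move=> i; rewrite ltn_ord.
have -> : trunc m h = h by apply/rowP => j; rewrite !mxE ltn_ord.
rewrite -[_ - _ - _]/(_) -addrA -opprD => /le_trans -> //.
have -> : d * `|h| *+ m = eps * `|h| * (m%:R / m.+1%:R) by rewrite /d -mulr_natr; ring.
apply: ler_piMr; first by apply: mulr_ge0 => //; exact: ltW.
by rewrite ler_pdivrMr// mul1r ler_nat.
Unshelve. all: by end_near. Qed.

Lemma C1_differentiable f x :
  (\forall y \near x, forall i, derivable f y (e_ i)) ->
  (forall i, {for x, continuous (fun y => 'D_(e_ i) f y)}) ->
  differentiable f x /\ forall v, 'D_v f x = \sum_i v 0 i * 'D_(e_ i) f x.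
Proof.
move=> df cf; have rem := C1_remainder df cf.
have D := diff_unique (@coordsum_continuous _) rem.
have dfx : differentiable f x.
  by apply/diff_locallyP; rewrite D; split => //; exact: coordsum_continuous.
by split => // v; rewrite deriveE// D.
Qed.

End C1.

(** * Stability of [Ck] under restriction, gluing, sums and composition *)

Section CkMore.
Context (R : realType) (m : nat).
Implicit Types (f : 'rV[R]_m -> R) (U V : set 'rV[R]_m).
Local Notation e_ i := (delta_mx 0 i : 'rV[R]_m).

Lemma Ck_cont k U f x : Ck k U f -> U x -> {for x, continuous f}.
Proof. by case: k => [|k] [+ _]; exact. Qed.

Lemma Ck_derivable k U f i x : Ck k.+1 U f -> U x -> derivable f x (e_ i).
Proof. by move=> [_ /(_ i)[+ _]]; exact. Qed.

Lemma Ck_derive k U f i : Ck k.+1 U f -> Ck k U (fun x => 'D_(e_ i) f x).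
Proof. by move=> [_ /(_ i)[]]. Qed.

Lemma CkSP k U f : (forall x, U x -> {for x, continuous f}) ->
  (forall i x, U x -> derivable f x (e_ i)) ->
  (forall i, Ck k U (fun x => 'D_(e_ i) f x)) -> Ck k.+1 U f.
Proof. by move=> cf df kf; split => // i; split => [x|]; [exact: df|exact: kf]. Qed.

Lemma Ck_subset k U V f : V `<=` U -> Ck k U f -> Ck k V f.
Proof.
move=> VU; elim: k f => [|k IH] f Cf; first by split => // x /VU; exact: Ck_cont Cf.
apply: CkSP => [x /VU|i x /VU|i]; [exact: Ck_cont Cf|exact: Ck_derivable Cf|].
exact/IH/Ck_derive.
Qed.

(** Each clause of [Ck] is imposed at the points of the set, but on the function in the whole space,
    so it glues. This is how functions extended from a chart are shown smooth. *)
Lemma Ck_setU k U V f : Ck k U f -> Ck k V f -> Ck k (U `|` V) f.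
Proof.
elim: k f => [|k IH] f Cf Cg.
  by split => // x []; [exact: Ck_cont Cf|exact: Ck_cont Cg].
apply: CkSP => [x []|i x []|i]; [exact: Ck_cont Cf|exact: Ck_cont Cg|
  exact: Ck_derivable Cf|exact: Ck_derivable Cg|].
by apply: IH; exact: Ck_derive.
Qed.

Lemma Ck_leq k l U f : (k <= l)%N -> Ck l U f -> Ck k U f.
Proof.
elim: l => [|l IH]; first by rewrite leqn0 => /eqP ->.
by rewrite leq_eqVlt => /orP[/eqP ->//|kl /CkS]; exact: IH.
Qed.

Lemma derive_coord i j x : 'D_(e_ i) (fun y : 'rV[R]_m => y 0 j) x = (i == j)%:R.
Proof.
have D := @derive_mx R 'rV[R]_m 1 m (fun y => y) x (e_ i) (@derivable_id _ _ x (e_ i)).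
by rewrite derive_id in D; have /rowP/(_ j) := D; rewrite !mxE eqxx/= eq_sym => ->.
Qed.

Lemma Ck_coord k U j : open U -> Ck k U (fun x => x 0 j).
Proof.
move=> Uo; have dc x : differentiable (fun y : 'rV[R]_m => y 0 j) x.
  exact: differentiable_coord.
case: k => [|k]; first by split => // x _; exact: differentiable_continuous.
apply: CkSP => [x _|i x _|i]; [exact: differentiable_continuous|exact: diff_derivable|].
by refine (Ck_ext Uo _ (Ck_cst Uo k (i == j)%:R)) => x _; rewrite derive_coord.
Qed.

Lemma Ck_sum k U (I : Type) (s : seq I) (F : I -> 'rV[R]_m -> R) : open U ->
  (forall i, Ck k U (F i)) -> Ck k U (fun x => \sum_(i <- s) F i x).
Proof.
move=> Uo CF; elim: s => [|i s IH].
  by refine (Ck_ext Uo _ (Ck_cst Uo k 0)) => x _; rewrite big_nil.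
by refine (Ck_ext Uo _ (CkD Uo (CF i) IH)) => x _; rewrite big_cons.
Qed.

Lemma Ck_differentiable k U f x : open U -> Ck k.+1 U f -> U x ->
  differentiable f x /\ forall v, 'D_v f x = \sum_i v 0 i * 'D_(e_ i) f x.
Proof.
move=> Uo Cf Ux; apply: C1_differentiable => [|i].
  apply: filterS (open_nbhs_nbhs (conj Uo Ux)) => y Uy i; exact: Ck_derivable Cf Uy.
exact: Ck_cont (Ck_derive i Cf) Ux.
Qed.

End CkMore.

Lemma cvg_rV (R : realType) (p : nat) (T : topologicalType) (F : set_system T)
  {FF : Filter F} (phi : T -> 'rV[R]_p) (l : 'rV[R]_p) :
  (forall j, (fun x => phi x 0 j) @ F --> l 0 j) -> phi @ F --> l.
Proof.
move=> cphi; apply/cvgrPdist_lt => eps eps0.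
have : \forall x \near F, forall j, `|l 0 j - phi x 0 j| < eps.
  by apply: filter_forall => j; have /cvgrPdist_lt := cphi j; exact.
apply: filterS => x lx; rewrite [ltLHS]/Num.Def.normr/= mx_normrE.
by apply: bigmax_lt => // -[i j] _ /=; rewrite !mxE ord1.
Qed.

Lemma derive_comp_rV (R : realType) (m p : nat) (h : 'rV[R]_p -> R)
  (phi : 'rV[R]_m -> 'rV[R]_p) x v :
  (forall j, differentiable (fun y => phi y 0 j) x) -> differentiable h (phi x) ->
  (forall w, 'D_w h (phi x) = \sum_j w 0 j * 'D_(delta_mx 0 j) h (phi x)) ->
  differentiable (h \o phi) x /\
  'D_v (h \o phi) x =
    \sum_j 'D_(delta_mx 0 j) h (phi x) * 'D_v (fun y => phi y 0 j) x.
Proof.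
move=> dphi dh Dh.
have dph : differentiable phi x.
  have -> : phi = \sum_j (fun y => phi y 0 j *: (delta_mx 0 j : 'rV[R]_p)).
    by apply/funext => y; rewrite fct_sumE [LHS]row_sum_delta.
  by apply: differentiable_sum => j; exact: differentiableZl.
split; first exact: differentiable_comp.
rewrite deriveE; last exact: differentiable_comp.
rewrite diff_comp//= -[X in 'd h _ X]deriveE// -deriveE// Dh.
apply: eq_bigr => j _; rewrite mulrC; congr (_ * _).
by rewrite derive_mx ?mxE//; exact: diff_derivable.
Qed.

(** By the chain rule a partial derivative of [h \o phi] is a sum of products of partial derivatives
    of [phi] with functions of the same form, [h] being replaced by its partial derivatives; hence
    the induction on [k] for all [h]. *)
Lemma Ck_comp (R : realType) (m p k : nat) (U : set 'rV[R]_m) (V : set 'rV[R]_p)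
  (h : 'rV[R]_p -> R) (phi : 'rV[R]_m -> 'rV[R]_p) :
  open U -> open V -> (forall x, U x -> V (phi x)) ->
  (forall j, Ck k U (fun x => phi x 0 j)) -> Ck k V h -> Ck k U (h \o phi).
Proof.
move=> Uo Vo UV; elim: k h => [|k IH] h Cphi Ch.
  split => // x Ux; apply: continuous_comp; last exact: Ck_cont Ch (UV _ Ux).
  by apply: (cvg_rV (FF := nbhs_filter x)) => j; exact: Ck_cont (Cphi j) Ux.
have D x v : U x -> differentiable (h \o phi) x /\
  'D_v (h \o phi) x =
    \sum_j 'D_(delta_mx 0 j) h (phi x) * 'D_v (fun y => phi y 0 j) x.
  move=> Ux; have [dh Dh] := Ck_differentiable Vo Ch (UV _ Ux).
  by apply: derive_comp_rV => // j; have [] := Ck_differentiable Uo (Cphi j) Ux.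
apply: CkSP => [x Ux|i x Ux|i].
- by apply: differentiable_continuous; have [] := D x 0 Ux.
- by apply: diff_derivable; have [] := D x 0 Ux.
refine (Ck_ext Uo _ (@Ck_sum _ _ k U _ (index_enum 'I_p)
  (fun j x => 'D_(delta_mx 0 j) h (phi x) * 'D_(delta_mx 0 i) (fun y => phi y 0 j) x) Uo _)).
  by move=> x /[!inE] Ux; have [_ ->] := D x (delta_mx 0 i) Ux.
move=> j; apply: CkM => //; last exact: Ck_derive.
by apply: (IH (fun y => 'D_(delta_mx 0 j) h y)); [move=> l; exact: CkS|exact: Ck_derive].
Qed.

(** * Bump functions *)

Section Flat.
Context (R : realType).
Implicit Types (P Q : {poly R}) (t : R).

(* Functions P(1/t) exp(-1/t) extended by 0, for all polynomials P at once: this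
   class is stable under differentiation. *)
Definition flat P t : R := if 0 < t then P.[t^-1] * expR (- t^-1) else 0.

Lemma flat_le0 P t : t <= 0 -> flat P t = 0.
Proof. by rewrite /flat ltNge => ->. Qed.

(** Induction on [P] for all [n]: multiplying [P] by the variable costs one power of [t], and a
    constant term is controlled by [expR x >= x ^+ n.+1 / n.+1!] at [x = t^-1]. *)
Lemma flat_bound P n : exists2 C, 0 <= C &
  forall t, 0 < t -> t <= 1 -> `|flat P t| <= C * t ^+ n.+1.
Proof.
elim/poly_ind: P n => [|P c IH] n.
  by exists 0 => // t t0 t1; rewrite /flat t0 horner0 !mul0r normr0.
have [C C0 CP] := IH n.+1.
exists (C + `|c| * n.+1`!%:R); first by rewrite addr_ge0// mulr_ge0.
move=> t t0 t1; have := CP t t0 t1; rewrite /flat t0 exprSr => Pt.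
rewrite hornerMXaddC !mulrDl (le_trans (ler_normD _ _))// lerD//.
  rewrite mulrAC normrM (@gtr0_norm _ t^-1) ?invr_gt0//.
  by rewrite ler_pdivrMr// -mulrA.
rewrite normrM -mulrA ler_wpM2l// ger0_norm ?expR_ge0// expRN.
have e0 : 0 < t^-1 ^+ n.+1 / n.+1`!%:R.
  by rewrite divr_gt0 ?exprn_gt0 ?invr_gt0// ltr0n fact_gt0.
have -> : n.+1`!%:R * t ^+ n.+1 = (t^-1 ^+ n.+1 / n.+1`!%:R)^-1.
  by rewrite invf_div exprVn invrK.
rewrite lef_pV2 ?posrE ?expR_gt0//.
apply: le_trans (expR_ge1Dxn n _); last by rewrite invr_ge0 ltW.
by rewrite lerDr.
Qed.

Lemma is_derive_horner P t : is_derive t 1 (horner P) (P^`().[t]).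
Proof. by split; [exact: derivable_horner|rewrite -derive1E derivE]. Qed.

Lemma is_derive_flat P t : is_derive t 1 (flat P) (flat ('X^2 * (P - P^`())) t).
Proof.
have [t0|t0|t0] := ltgtP 0 t; last subst t.
- have E : \near t, P.[t^-1] * expR (- t^-1) = flat P t.
    by near=> s; rewrite /flat; have -> : 0 < s by near: s; exact: lt_nbhsr.
  apply: near_eq_is_derive E _.
  have dV : is_derive t 1 (fun s : R => s^-1) (- t ^- 2 *: 1).
    by apply: is_deriveV; rewrite gt_eqF.
  have dN := is_deriveN dV.
  have d1 := is_derive1_comp (is_derive_horner P _) dV.
  have d2 := is_derive1_comp (is_derive_expR _) dN.
  apply: (is_derive_eq (is_deriveM d1 d2)).
  rewrite /flat t0 hornerM hornerXn hornerD hornerN.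
  have -> : (- t ^- 2)%:A = - t^-1 ^+ 2 :> R by rewrite [LHS]mulr1 exprVn.
  set a := t^-1 ^+ 2.
  rewrite -[LHS]/(P.[t^-1] * (expR (- t^-1) * - - a) + expR (- t^-1) * (P^`().[t^-1] * - a)).
  ring.
- rewrite flat_le0 ?ltW//.
  have E : \near t, cst 0 t = flat P t.
    by near=> s; rewrite flat_le0//; apply: ltW; near: s; exact: lt_nbhsl.
  by apply: near_eq_is_derive E _; exact: is_derive_cst.
(* At [0] a bound by [C * t ^+ 2] is needed, so that the difference quotient is at most [C * h] and
   tends to [0]. *)
have [C C0 CP] := flat_bound P 1.
rewrite flat_le0//.
have cvg0 : h^-1 *: ((flat P \o shift 0) (h *: 1) - flat P 0) @[h --> 0^'] --> (0 : R).
  apply/cvgr0Pnorm_lt => e e0 /=; near=> h.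
  rewrite [h *: 1]mulr1 addr0 (flat_le0 _ (lexx 0)) subr0.
  have h0 : h != 0 by near: h; exact: nbhs_dnbhs_neq.
  have [hle|hgt] := leP h 0; first by rewrite (flat_le0 _ hle) scaler0 normr0.
  have h1 : `|h| < 1 by near: h; exact: dnbhs0_lt.
  have hC : `|h| < e / (C + 1) by near: h; apply: dnbhs0_lt; rewrite divr_gt0// ltr_wpDl.
  rewrite (gtr0_norm hgt) in h1 hC.
  rewrite normrM normfV (gtr0_norm hgt) mulrC ltr_pdivrMr//.
  apply: le_lt_trans (CP _ hgt (ltW h1)) _.
  rewrite expr2 mulrA ltr_pM2r//.
  move: hC; rewrite ltr_pdivlMr ?ltr_wpDl// mulrDr mulr1 mulrC.
  by apply: le_lt_trans; rewrite lerDl ltW.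
split; first by apply/cvg_ex; exists 0.
exact: cvg_lim cvg0.
Unshelve. all: by end_near. Qed.

Context (m : nat) (U : set 'rV[R]_m) (Uo : open U).

Lemma Ck_flat k P (u : 'rV[R]_m -> R) : (forall l, Ck l U u) -> Ck k U (flat P \o u).
Proof.
move=> Cu; elim: k P => [|k IH] P.
  split => // x Ux; apply: continuous_comp; first exact: Ck_cont (Cu 0%N) Ux.
  by apply/differentiable_continuous/derivable1_diffP; have [] := is_derive_flat P (u x).
have df s : differentiable (flat P) s.
  by apply/derivable1_diffP; have [] := is_derive_flat P s.
have D x v : U x -> differentiable (flat P \o u) x /\
    'D_v (flat P \o u) x = flat ('X^2 * (P - P^`())) (u x) * 'D_v u x.
  move=> Ux; have [du _] := Ck_differentiable Uo (Cu 1%N) Ux.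
  split; first exact: differentiable_comp.
  rewrite deriveE; last exact: differentiable_comp.
  rewrite diff_comp//= -[X in 'd (flat P) _ X]deriveE//.
  by rewrite diff1E// /GRing.scale/= mulrC derive1E; have [_ ->] := is_derive_flat P (u x).
apply: CkSP => [x Ux|i x Ux|i].
- by apply: differentiable_continuous; have [] := D x 0 Ux.
- by apply: diff_derivable; have [] := D x 0 Ux.
refine (Ck_ext Uo _ (CkM Uo (IH ('X^2 * (P - P^`()))) (Ck_derive i (Cu k.+1)))).
by move=> x /[!inE] Ux; have [_ ->] := D x (delta_mx 0 i) Ux.
Qed.

End Flat.

Section Bump.
Context (R : realType) (m : nat).
Implicit Types (x q : 'rV[R]_m) (r : R).

(** The squared Euclidean distance is polynomial, hence smooth, unlike the maximum norm of row
    vectors that measures the support below. *)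
Definition bumpf q r x : R := flat 1 (r ^+ 2 - \sum_i (x 0 i - q 0 i) * (x 0 i - q 0 i)).

Lemma Ck_bump k q r : Ck k setT (bumpf q r).
Proof.
apply: Ck_flat; first exact: openT.
move=> l; have To := @openT ('rV[R]_m).
apply: CkD => //; first exact: Ck_cst.
refine (Ck_ext To _ (CkM To (Ck_cst To l (-1)) (@Ck_sum _ _ l setT _ (index_enum 'I_m)
  (fun i x => (x 0 i + - q 0 i) * (x 0 i + - q 0 i)) To _))).
  by move=> x _; rewrite mulN1r.
have Cc i : Ck l setT (fun x : 'rV[R]_m => x 0 i + - q 0 i).
  by apply: CkD => //; [exact: Ck_coord|exact: Ck_cst].
by move=> i; exact: CkM.
Qed.

Lemma bump_gt0 q r : 0 < r -> 0 < bumpf q r q.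
Proof.
move=> r0; rewrite /bumpf big1 => [|i _]; last by rewrite subrr mul0r.
by rewrite subr0 /flat exprn_gt0// hornerC mul1r expR_gt0.
Qed.

Lemma bump_supp q r x : 0 < r -> r <= `|x - q| -> bumpf q r x = 0.
Proof.
move=> r0 rx; apply: flat_le0; rewrite subr_le0.
have sge0 i : 0 <= (x 0 i - q 0 i) * (x 0 i - q 0 i) by rewrite -expr2 sqr_ge0.
(* In the maximum norm some coordinate realises the distance, and its square alone already reaches
   [r ^+ 2]. *)
suff : exists i, r <= `|x 0 i - q 0 i|.
  case=> i ri; rewrite (bigD1 i)//= -expr2 ler_wpDr ?sumr_ge0//.
  by rewrite -[leRHS]real_normK ?num_real// ler_sqr ?nnegrE ?(ltW r0).
apply: contrapT => /forallNP H; move: rx; rewrite leNgt => /negP; apply.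
rewrite [ltLHS]/Num.Def.normr/= mx_normrE; apply: bigmax_lt => // -[i j] _ /=.
by rewrite ord1 !mxE ltNge; apply/negP; exact: H.
Qed.

End Bump.

(** * Hadamard's lemma *)

Section UnitInterval.
Context (R : realType).
Implicit Types f g : R -> R.
Local Notation mu := (@lebesgue_measure R).

Definition int01 f : R := \int[mu]_(t in `[0, 1]) f t.

Definition cont01 f := {within `[0, 1], continuous f}.

Lemma cont01_integrable f : cont01 f -> mu.-integrable `[0, 1] (EFin \o f).
Proof. by apply: continuous_compact_integrable; exact: segment_compact. Qed.

Lemma int01_near f g e : cont01 f -> cont01 g ->
  (forall t, 0 <= t <= 1 -> `|f t - g t| <= e) -> `|int01 f - int01 g| <= e.
Proof.
move=> cf cg fg; have [fi gi] := (cont01_integrable cf, cont01_integrable cg).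
have cfg : cont01 (fun t => f t - g t) by move=> x; apply: cvgB; [exact: cf|exact: cg].
have fgi := cont01_integrable cfg.
rewrite -RintegralB//; apply: le_trans (le_normr_Rintegral _ fgi) _ => //.
have -> : e = \int[mu]_(t in `[0, 1]) e.
  by rewrite Rintegral_cst//= lebesgue_measure_itv/= lte_fin ltr01 -EFinB subr0 mulr1.
apply: le_Rintegral => //.
- by apply: cont01_integrable => x; apply: cvg_norm; exact: cfg.
- by apply: cont01_integrable; exact: cst_continuous.
Qed.

Lemma int01Zl c f : cont01 f -> int01 (fun t => c * f t) = c * int01 f.
Proof. by move=> cf; rewrite -RintegralZl//; exact: cont01_integrable. Qed.

Lemma int01B f g : cont01 f -> cont01 g -> int01 (fun t => f t - g t) = int01 f - int01 g.
Proof. by move=> cf cg; rewrite -RintegralB//; exact: cont01_integrable. Qed.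

Lemma int01_sum (I : Type) (s : seq I) (F : I -> R -> R) : (forall i, cont01 (F i)) ->
  cont01 (fun t => \sum_(i <- s) F i t) /\
  int01 (fun t => \sum_(i <- s) F i t) = \sum_(i <- s) int01 (F i).
Proof.
move=> cF; elim: s => [|i s [IHc IH]].
  have -> : (fun t => \sum_(i <- [::]) F i t) = cst 0 by apply/funext => t; rewrite big_nil.
  by split; [exact: cst_continuous|rewrite big_nil /int01 Rintegral_cst// mul0r].
have -> : (fun t => \sum_(j <- (i :: s)) F j t) = (fun t => F i t + \sum_(j <- s) F j t).
  by apply/funext => t; rewrite big_cons.
split; first by move=> x; apply: cvgD; [exact: cF|exact: IHc].
by rewrite big_cons -IH -RintegralD//; exact: cont01_integrable.
Qed.

Lemma int01_FTC f (F : R -> R) : cont01 f ->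
  (forall t : R, 0 <= t <= 1 -> is_derive t 1 F (f t)) ->
  int01 f = F 1 - F 0.
Proof.
move=> cf dF; have cF t : 0 <= t <= 1 -> {for t, continuous F}.
  by move=> /dF[dFt _]; apply/differentiable_continuous/derivable1_diffP.
rewrite /int01 /Rintegral (@continuous_FTC2 _ f F)//.
- split=> [t|/=|].
  + by rewrite in_itv/= => /andP[t0 t1]; have [] := dF t; rewrite ?ltW.
  + by apply/cvg_at_right_filter/cF; rewrite lexx ler01.
  + by apply/cvg_at_left_filter/cF; rewrite lexx ler01.
- move=> t; rewrite in_itv/= => /andP[t0 t1]; rewrite derive1E.
  by have [] := dF t; rewrite ?ltW.
Qed.

End UnitInterval.

(** * Averages along the segments issued from the centre of a ball *)

Section Hadamard.
Context (R : realType) (m : nat) (q : 'rV[R]_m) (r : R).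
Implicit Types (phi : 'rV[R]_m -> R) (x : 'rV[R]_m) (t : R).
Local Notation e_ i := (delta_mx 0 i : 'rV[R]_m).
Local Notation U := [set x | `|x - q| < r].

Definition segm t x : 'rV[R]_m := t *: (x - q) + q.

Lemma segm_in t x : 0 <= t <= 1 -> U x -> U (segm t x).
Proof.
move=> /andP[t0 t1] /= Ux; rewrite /segm addrK normrZ ger0_norm//.
by apply: le_lt_trans Ux; rewrite ler_piMl.
Qed.

Lemma norm_ball_open : open U.
Proof.
rewrite (_ : U = ball q r); first exact: ball_open.
by apply/funext => x; rewrite -ball_normE /= distrC.
Qed.

Lemma segm_cvg t x : (fun p : R * 'rV[R]_m => segm p.1 p.2) @ (t, x) --> segm t x.
Proof.
apply: cvgD; last exact: cvg_cst.
by apply: cvgZ; [exact: cvg_fst|apply: cvgB; [exact: cvg_snd|exact: cvg_cst]].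
Qed.

(** A tube lemma: compactness of [[0, 1]] makes the joint continuity in [(t, y)] uniform in [t]. *)
Lemma segm_unif phi x e : (forall y, U y -> {for y, continuous phi}) -> U x -> 0 < e ->
  \forall y \near x, forall t, 0 <= t <= 1 -> `|phi (segm t y) - phi (segm t x)| < e.
Proof.
move=> cphi Ux e0.
have := (compact_near_coveringP _).1 (@segment_compact R 0 1) 'rV[R]_m (nbhs x)
  (fun y t => `|phi (segm t y) - phi (segm t x)| < e) _.
move=> cov; have {cov} : \forall y \near x,
    `[0, 1] `<=` (fun t => `|phi (segm t y) - phi (segm t x)| < e).
  apply: cov => t; rewrite /= in_itv/= => t01.
  have cG : (fun p : R * 'rV[R]_m => phi (segm p.1 p.2)) @ (t, x) --> phi (segm t x).
    apply: (@cvg_comp _ _ _ (fun p : R * 'rV[R]_m => segm p.1 p.2) phi); first exact: segm_cvg.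
    exact: (cphi _ (segm_in t01 Ux)).
  have e2 : 0 < e / 2 by rewrite divr_gt0.
  have /cvgrPdist_lt/(_ _ e2) := cG; case=> -[A B] /= [At Bx] AB.
  exists (A, B) => //= -[t' y] [/= At' By].
  have h1 := AB (t', y) (conj At' By); have h2 := AB (t', x) (conj At' (nbhs_singleton Bx)).
  rewrite /= in h1 h2; rewrite distrC in h1.
  rewrite -(subrKA (phi (segm t x))) (splitr e).
  exact: le_lt_trans (ler_normD _ _) (ltrD h1 h2).
by apply: filterS => y Hy t t01; apply: Hy; rewrite /= in_itv.
Qed.

(* Hadamard's lemma needs only k = 0; differentiating under the integral sign
   raises k by one. *)
Definition avg k phi x : R := int01 (fun t => t ^+ k * phi (segm t x)).

Lemma segm_cont01 k phi x : (forall y, U y -> {for y, continuous phi}) -> U x ->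
  forall t, 0 <= t <= 1 -> {for t, continuous (fun t => t ^+ k * phi (segm t x))}.
Proof.
move=> cphi Ux t t01; apply: cvgM; first exact: exprn_continuous.
apply: (@cvg_comp _ _ _ (fun t => segm t x) phi); last exact: (cphi _ (segm_in t01 Ux)).
apply: cvgD; last exact: cvg_cst.
by apply: cvgZl; exact: cvg_id.
Qed.

Lemma avg_cont01 k phi x : (forall y, U y -> {for y, continuous phi}) -> U x ->
  cont01 (fun t => t ^+ k * phi (segm t x)).
Proof.
move=> cphi Ux; apply: continuous_in_subspaceT => t; rewrite inE/= in_itv/=.
exact: segm_cont01.
Qed.

Lemma near_U x : U x -> \forall y \near x, U y.
Proof. by move=> Ux; apply: open_nbhs_nbhs; split => //; exact: norm_ball_open. Qed.

Lemma avg_continuous k phi x : (forall y, U y -> {for y, continuous phi}) -> U x ->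
  {for x, continuous (avg k phi)}.
Proof.
move=> cphi Ux; apply/(@cvgrPdist_le _ _ _ _ (nbhs_filter x)) => e e0.
apply: filterS2 _ (near_U Ux) (segm_unif cphi Ux e0) => y Uy Hy.
apply: int01_near; [exact: avg_cont01|exact: avg_cont01|].
move=> t t01; rewrite -mulrBr normrM distrC -[e]mul1r.
have /andP[t0 t1] := t01.
by rewrite ler_pM ?normr_ge0 ?(ltW (Hy t t01))// normrX exprn_ile1 ?normr_ge0// ger0_norm.
Qed.

(** Differentiation under the integral sign: the mean value theorem turns the difference quotient
    into [t ^+ k.+1] times a partial derivative at a nearby point, the extra [t] coming from [segm],
    and [segm_unif] gives uniform convergence. *)
Lemma avg_derive k phi i x : Ck 1 U phi -> U x ->
  is_derive x (e_ i) (avg k phi) (avg k.+1 (fun y => 'D_(e_ i) phi y) x).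
Proof.
move=> Cphi Ux; set dphi := fun y => 'D_(e_ i) phi y.
have cphi y : U y -> {for y, continuous phi} by exact: Ck_cont Cphi.
have cdphi y : U y -> {for y, continuous dphi} by exact: Ck_cont (Ck_derive i Cphi).
suff cvgD : h^-1 *: ((avg k phi \o shift x) (h *: e_ i) - avg k phi x) @[h --> 0^'] -->
    avg k.+1 dphi x.
  by split; [apply/cvg_ex; exists (avg k.+1 dphi x)|exact: cvg_lim cvgD].
apply/cvgrPdist_le => e e0.
have : \forall y \near x, U y /\
    forall t, 0 <= t <= 1 -> `|dphi (segm t y) - dphi (segm t x)| < e.
  by apply: filterS2 _ (near_U Ux) (segm_unif cdphi Ux e0) => y.
case/nbhs_ballP => d /= d0; rewrite -ball_normE => bd.
near=> h.
have h0 : h != 0 by near: h; exact: nbhs_dnbhs_neq.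
have hd : `|h| < d by near: h; exact: dnbhs0_lt.
have good s : `|s| <= `|h| -> ball_ Num.norm x d (s *: e_ i + x).
  move=> sh; rewrite /ball_/= opprD addrCA subrr addr0 normrN normrZ.
  apply: le_lt_trans hd; apply: le_trans sh; rewrite ler_piMr//; exact: norm_delta_le.
have [Uh _] := bd _ (good h (lexx _)).
have ch : cont01 (fun t =>
    h^-1 * (t ^+ k * phi (segm t (h *: e_ i + x)) - t ^+ k * phi (segm t x))).
  move=> t; apply: cvgM; first exact: cvg_cst.
  by apply: cvgB; exact: avg_cont01.
rewrite /= -[X in _ - X]/(h^-1 * (_ - _)) -int01B; [|exact: avg_cont01..].
rewrite -int01Zl; last by move=> t; apply: cvgB; exact: avg_cont01.
apply: int01_near => [|//|t t01]; first exact: avg_cont01.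
have segmD s : segm t (s *: e_ i + x) = (t * s) *: e_ i + segm t x.
  by rewrite /segm -addrA scalerDr scalerA -addrA.
have /andP[t0 t1] := t01.
(* Intermediate points are rewritten as [segm t] of points near [x], to which the uniform estimate
   applies; [t = 0] is separate because of the division by [t]. *)
have below s : `|s| <= `|t * h| -> exists2 s', s = t * s' & `|s'| <= `|h|.
  rewrite normrM (ger0_norm t0) => sh.
  have [tz|tnz] := eqVneq t 0.
    exists 0; rewrite ?normr0// mulr0; apply/normr0_eq0/le_anti.
    by rewrite normr_ge0 (le_trans sh)// tz mul0r.
  exists (s / t); first by rewrite mulrC divfK.
  by rewrite normrM normfV (ger0_norm t0) ler_pdivrMr ?lt_neqAle 1?eq_sym ?tnz// mulrC.
have [s sth mvt] : exists2 s, `|s| <= `|t * h| &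
    phi (segm t (h *: e_ i + x)) - phi (segm t x) = (t * h) * dphi (s *: e_ i + segm t x).
  rewrite segmD; apply: MVT_line => s /below[s' -> s'h]; rewrite -segmD.
  apply: Ck_derivable Cphi _; apply: segm_in => //.
  by have [] := bd _ (good _ s'h).
have [s' es s'h] := below _ sth; rewrite es -segmD in mvt.
rewrite -mulrBr mvt exprS.
set a := dphi (segm t x); set b := dphi (segm t (s' *: e_ i + x)).
have -> : t * t ^+ k * a - h^-1 * (t ^+ k * (t * h * b)) = t ^+ k.+1 * (a - b).
  by rewrite exprS; field.
rewrite normrM distrC -[e]mul1r ler_pM//.
  by rewrite normrX exprn_ile1// ger0_norm.
by have [_ /(_ t t01)/ltW] := bd _ (good _ s'h).
Unshelve. all: by end_near. Qed.

Lemma Ck_avg l k phi : Ck l U phi -> Ck l U (avg k phi).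
Proof.
elim: l k phi => [|l IH] k phi Cphi.
  by split => // x Ux; apply: avg_continuous Ux => y; exact: Ck_cont Cphi.
have Cphi1 : Ck 1 U phi by exact: Ck_leq Cphi.
apply: CkSP => [x Ux|i x Ux|i].
- by apply: avg_continuous Ux => y; exact: Ck_cont Cphi.
- by have [] := avg_derive k i Cphi1 Ux.
refine (Ck_ext norm_ball_open _ (IH k.+1 _ (Ck_derive i Cphi))) => x /[!inE] Ux.
by have [_ ->] := avg_derive k i Cphi1 Ux.
Qed.

Lemma avg_center phi : avg 0 phi q = phi q.
Proof.
rewrite /avg (_ : (fun t => _) = cst (phi q)).
  by rewrite /int01 Rintegral_cst//= lebesgue_measure_itv/= lte_fin ltr01 -EFinB subr0 mulr1.
by apply/funext => t; rewrite /segm subrr scaler0 add0r expr0 mul1r.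
Qed.

(** Integrate the derivative of [phi] along the segment from [q] to [x]; [h i] is the average of the
    [i]-th partial derivative. *)
Lemma Hadamard phi : 0 < r -> (forall l, Ck l U phi) ->
  exists h : 'I_m -> 'rV[R]_m -> R, [/\ forall i l, Ck l U (h i),
    forall i, h i q = 'D_(e_ i) phi q
    & forall x, U x -> phi x = phi q + \sum_i (x 0 i - q 0 i) * h i x].
Proof.
move=> r0 Cphi; exists (fun i => avg 0 (fun y => 'D_(e_ i) phi y)).
split=> [i l|i|x Ux]; [by apply: Ck_avg; exact: Ck_derive|exact: avg_center|].
have cd i y : U y -> {for y, continuous (fun y => 'D_(e_ i) phi y)}.
  exact: Ck_cont (Ck_derive i (Cphi 1%N)).
pose G i t := (x 0 i - q 0 i) * (t ^+ 0 * 'D_(e_ i) phi (segm t x)).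
have cG i : cont01 (G i).
  by move=> t; apply: cvgM; [exact: cvg_cst|exact: (avg_cont01 (cd i))].
have [csumG sumG] := int01_sum (index_enum 'I_m) cG.
have -> : \sum_i (x 0 i - q 0 i) * avg 0 (fun y => 'D_(e_ i) phi y) x
    = int01 (fun t => \sum_i G i t).
  rewrite sumG; apply: eq_bigr => i _; rewrite /G int01Zl//; exact: (avg_cont01 (cd i)).
have phi1 : phi x = phi (segm 1 x) by rewrite /segm scale1r subrK.
have phi0 : phi q = phi (segm 0 x) by rewrite /segm scale0r add0r.
suff dphi t : 0 <= t <= 1 -> is_derive t (1 : R) (fun t => phi (segm t x)) (\sum_i G i t).
  by rewrite (int01_FTC csumG dphi) -phi1 -phi0 subrKC.
move=> t01; have [df Df] := Ck_differentiable norm_ball_open (Cphi 1%N) (segm_in t01 Ux).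
have := is_derive_line (diff_derivable (v := x - q) df); rewrite Df => dl.
apply: (is_derive_eq dl); apply: eq_bigr => i _.
by rewrite /G expr0 mul1r !mxE.
Qed.

End Hadamard.

(** * Vector fields and tensors on a manifold *)

Section Charts.
Context (R : realType) (m : nat) (M : manifold R m).
Implicit Types (a b : chart R m M) (p : M) (w : 'rV[R]_m -> R).

Lemma chart_invK a p : chart_dom a p -> chart_inv a (chart_map a p) = p.
Proof. by move=> ap; apply: chart_mapK; exact/mem_set. Qed.

Lemma chart_inv_dom a x : chart_cod a x -> chart_dom a (chart_inv a x).
Proof. by case=> p ap <-; rewrite chart_invK. Qed.

Lemma chart_codK a x : chart_cod a x -> chart_map a (chart_inv a x) = x.
Proof. by case=> p ap <-; rewrite chart_invK. Qed.

Lemma chart_cod_map a p : chart_dom a p -> chart_cod a (chart_map a p).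
Proof. by move=> ap; exists p. Qed.

Lemma chart_image_open a (O : set M) : open O -> open (chart_map a @` (chart_dom a `&` O)).
Proof.
move=> Oo.
have -> : chart_map a @` (chart_dom a `&` O) = chart_cod a `&` chart_inv a @^-1` O.
  apply/seteqP; split=> [_ [p [ap Op] <-]|x [ax Ox]] /=.
    by split; [exact: chart_cod_map|rewrite chart_invK].
  by exists (chart_inv a x); [split => //; exact: chart_inv_dom|exact: chart_codK].
have co : open (chart_cod a) := @chart_cod_open _ _ _ a.
apply: (continuous_inP _ co).1 Oo.
by rewrite -continuous_open_subspace//; exact: chart_inv_cont.
Qed.

Lemma chart_preimage_open a (V : set 'rV[R]_m) : open V ->
  open (chart_dom a `&` chart_map a @^-1` V).
Proof.
move=> Vo; have ao : open (chart_dom a) := @chart_dom_open _ _ _ a.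
apply: (continuous_inP _ ao).1 Vo.
by rewrite -continuous_open_subspace//; exact: chart_map_cont.
Qed.

Definition chart_ext a w (p : M) : R :=
  if p \in chart_dom a then w (chart_map a p) else 0.

Lemma chart_extE a w p : chart_dom a p -> chart_ext a w p = w (chart_map a p).
Proof. by move=> ap; rewrite /chart_ext mem_set. Qed.

Lemma chart_ext0 a w p : ~ chart_dom a p -> chart_ext a w p = 0.
Proof. by move=> ap; rewrite /chart_ext memNset. Qed.

Lemma chart_ext_smooth a w (K U : set 'rV[R]_m) : @atlas _ _ M a -> open U ->
  U `<=` chart_cod a -> compact K -> K `<=` U -> (forall l, Ck l U w) ->
  (forall x, chart_cod a x -> ~ K x -> w x = 0) -> smooth (chart_ext a w).
Proof.
move=> Aa Uo Ua Kc KU Cw w0 b Ab k.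
(* The Hausdorff axiom is used here: K stays closed in M, so that outside the
   chart the extension vanishes near every point. *)
have iKc : closed (chart_inv a @` K).
  apply: compact_closed; first exact: manifold_hausdorff.
  apply: continuous_compact Kc; apply: continuous_subspaceW (@chart_inv_cont _ _ _ a).
  by move=> x /KU /Ua.
(* [W1] and [W2] are open and cover the codomain of [b]: on [W1] the extension is [w] after a
   transition map, on [W2] it is zero. *)
pose O1 := chart_dom a `&` chart_map a @^-1` U.
pose W1 := chart_map b @` (chart_dom b `&` O1).
pose W2 := chart_map b @` (chart_dom b `&` ~` (chart_inv a @` K)).
have W1o : open W1 by apply: chart_image_open; exact: chart_preimage_open.
have W2o : open W2 by apply: chart_image_open; exact: closed_openC.
have C1 : Ck k W1 (chart_ext a w \o chart_inv b).
  have Cwt : Ck k W1 (w \o (fun y => chart_map a (chart_inv b y))).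
    apply: (Ck_comp W1o Uo) => [_ [p [bp [ap pU]] <-]|j|]; rewrite ?chart_invK//.
    apply: Ck_subset (@atlas_smooth _ _ M b a Ab Aa j k).
    by move=> _ [p [bp [ap pU]] <-]; exists p.
  refine (Ck_ext W1o _ Cwt) => y /[!inE] -[p [bp [ap pU]] <-] /=.
  by rewrite chart_invK// chart_extE.
have C2 : Ck k W2 (chart_ext a w \o chart_inv b).
  refine (Ck_ext W2o _ (Ck_cst W2o k 0)) => y /[!inE] -[p [bp pK] <-] /=.
  rewrite chart_invK//; have [ap|ap] := pselect (chart_dom a p); last by rewrite chart_ext0.
  rewrite chart_extE// w0//; first exact: chart_cod_map.
  by move=> Kp; apply: pK; exists (chart_map a p) => //; rewrite chart_invK.
apply: Ck_subset (Ck_setU C1 C2) => _ [p bp <-].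
have [[x Kx xp]|pK] := pselect ((chart_inv a @` K) p); last by right; exists p.
have ax := Ua _ (KU _ Kx); left; exists p => //; split => //.
by rewrite -xp; split; [exact: chart_inv_dom|rewrite /= chart_codK//; exact: KU].
Qed.

Lemma smooth_Cfun (f : Cinf M) : smooth f.
Proof. exact/asboolP/CfunP. Qed.

(** A total conversion, with default value [0] when [f] is not smooth. *)
Definition toC (f : M -> R) : Cinf M := insubd 0 f.

Lemma toCE f : smooth f -> toC f = f :> (M -> R).
Proof.
by move=> sf; rewrite /toC val_insubd; have -> : f \in @smooth_pred R m M by exact/asboolP.
Qed.

Lemma CinfP (f g : Cinf M) : (forall p, f p = g p) -> f = g.
Proof. by move=> fg; apply: val_inj; exact/funext. Qed.

Lemma CinfD (f g : Cinf M) p : (f + g) p = f p + g p. Proof. by []. Qed.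
Lemma CinfN (f : Cinf M) p : (- f) p = - f p. Proof. by []. Qed.
Lemma CinfM (f g : Cinf M) p : (f * g) p = f p * g p. Proof. by []. Qed.
Lemma Cinf0 p : (0 : Cinf M) p = 0. Proof. by []. Qed.
Lemma Cinf1 p : (1 : Cinf M) p = 1. Proof. by []. Qed.
Lemma Cinf_sum (I : Type) (s : seq I) (F : I -> Cinf M) p :
  (\sum_(i <- s) F i) p = \sum_(i <- s) F i p.
Proof. by elim: s => [|i s IH]; rewrite ?big_nil// !big_cons CinfD IH. Qed.

Lemma vf_sum (Y : vfield M) (I : Type) (s : seq I) (F : I -> Cinf M) :
  Y (\sum_(i <- s) F i) = \sum_(i <- s) Y (F i).
Proof. by elim: s => [|i s IH]; rewrite ?big_nil ?vf0// !big_cons vfD IH. Qed.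

Lemma vfield_sum (I : Type) (s : seq I) (F : I -> vfield M) f :
  (\sum_(i <- s) F i) f = \sum_(i <- s) F i f.
Proof. by elim: s => [|i s IH]; rewrite ?big_nil// !big_cons -IH. Qed.

End Charts.

(** * Partial derivatives read in a chart *)

Section LocalDerivatives.
Context (R : realType) (m : nat) (M : manifold R m) (a : chart R m M).
Hypothesis Aa : @atlas _ _ M a.
Implicit Types (f g : Cinf M) (x : 'rV[R]_m) (i : 'I_m).
Local Notation e_ i := (delta_mx 0 i : 'rV[R]_m).

Definition Dloc i f x : R := 'D_(e_ i) (f \o chart_inv a) x.

Lemma Ck_loc l f : Ck l (chart_cod a) (f \o chart_inv a).
Proof. exact: smooth_Cfun. Qed.

Lemma Ck_Dloc l i f : Ck l (chart_cod a) (Dloc i f).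
Proof. exact/Ck_derive/Ck_loc. Qed.

Lemma derivable_loc i f x : chart_cod a x -> derivable (f \o chart_inv a) x (e_ i).
Proof. by move=> ax; exact: Ck_derivable (Ck_loc 1 f) ax. Qed.

Lemma DlocD i f g x : chart_cod a x -> Dloc i (f + g) x = Dloc i f x + Dloc i g x.
Proof. by move=> ax; rewrite -deriveD//; exact: derivable_loc. Qed.

Lemma DlocM i f g x : chart_cod a x ->
  Dloc i (f * g) x = f (chart_inv a x) * Dloc i g x + Dloc i f x * g (chart_inv a x).
Proof.
move=> ax; rewrite [RHS]addrC [Dloc i f x * _]mulrC.
by rewrite [RHS]addrC -[RHS]deriveM//; exact: derivable_loc.
Qed.

Lemma Dloc_cst i c x : Dloc i (cstC M c) x = 0.
Proof. exact: derive_cst. Qed.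

End LocalDerivatives.

(** * Coordinates and coordinate fields cut off by a bump *)

Section CoordinateFields.
Context (R : realType) (m : nat) (M : manifold R m) (a : chart R m M).
Hypothesis Aa : @atlas _ _ M a.
Context (q : 'rV[R]_m) (r : R).
Hypothesis r0 : 0 < r.
Local Notation U := [set x : 'rV[R]_m | `|x - q| < r].
Hypothesis Ua : U `<=` chart_cod a.
Local Notation e_ i := (delta_mx 0 i : 'rV[R]_m).
Local Notation rho := (bumpf q (r / 2)).
Implicit Types (f g : Cinf M) (w : 'rV[R]_m -> R) (p : M) (i j : 'I_m).

(** The bump has radius [r / 2], so its support lies in a compact part of [U]; a function smooth
    only on [U] thus becomes a smooth function on [M]. *)
Definition bump_ext w : Cinf M := toC (chart_ext a (fun x => rho x * w x)).

Lemma closed_disk_compact : compact [set x : 'rV[R]_m | `|x - q| <= r / 2].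
Proof.
apply: bounded_closed_compact.
  exists (r / 2 + `|q|); split; first exact: num_real.
  move=> b rb x /= xq; apply: le_trans (ltW rb); rewrite -(subrK q x).
  by apply: le_trans (ler_normD _ _) _; rewrite lerD2r.
rewrite (_ : mkset _ = closed_ball q (r / 2)); first exact: closed_ball_closed.
by rewrite closed_ballE ?divr_gt0//; apply/funext => x; rewrite /closed_ball_/= distrC.
Qed.

Lemma bump_ext_smooth w : (forall l, Ck l U w) -> smooth (chart_ext a (fun x => rho x * w x)).
Proof.
have Uo := @norm_ball_open R m q r.
move=> Cw; apply: (chart_ext_smooth Aa Uo Ua closed_disk_compact).
- by move=> x /= xq; apply: le_lt_trans xq _; rewrite ltr_pdivrMr// ltr_pMr// ltr1n.
- by move=> l; apply: CkM => //; exact: Ck_subset (Ck_bump _ _ _).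
move=> x _ /= /negP; rewrite -ltNge => xq.
by rewrite bump_supp ?mul0r ?divr_gt0// ltW.
Qed.

Lemma bump_extE w p : (forall l, Ck l U w) -> chart_dom a p ->
  bump_ext w p = rho (chart_map a p) * w (chart_map a p).
Proof. by move=> Cw ap; rewrite /bump_ext toCE ?chart_extE//; exact: bump_ext_smooth. Qed.

Lemma bump_ext0 w p : (forall l, Ck l U w) -> ~ chart_dom a p -> bump_ext w p = 0.
Proof. by move=> Cw ap; rewrite /bump_ext toCE ?chart_ext0//; exact: bump_ext_smooth. Qed.

Lemma Ck_DlocU l i f : Ck l U (Dloc a i f).
Proof. by apply: Ck_subset Ua _; exact: Ck_Dloc. Qed.

Fact cfield_subproof i : derivation (fun f => bump_ext (Dloc a i f)).
Proof.
have C f l := Ck_DlocU l i f; split => [f g|c f|f g]; apply: CinfP => p.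
all: rewrite ?(CinfD, CinfM).
all: have [ap|ap] := pselect (chart_dom a p); last by rewrite !bump_ext0//; ring.
all: have cp := chart_cod_map ap; rewrite !bump_extE//.
- by rewrite DlocD//; ring.
- by rewrite DlocM// Dloc_cst mul0r addr0 chart_invK//; ring.
- by rewrite DlocM// chart_invK//; ring.
Qed.

Definition cfield i : vfield M := VField (cfield_subproof i).

Lemma cfieldE i f p : chart_dom a p ->
  cfield i f p = rho (chart_map a p) * Dloc a i f (chart_map a p).
Proof. by move=> ap; rewrite /= bump_extE//= => l; exact: Ck_DlocU. Qed.

Lemma cfield0 i f p : ~ chart_dom a p -> cfield i f p = 0.
Proof. by move=> ap; rewrite /= bump_ext0//= => l; exact: Ck_DlocU. Qed.

Definition bumpC : Cinf M := bump_ext (fun=> 1).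
Definition coordC i : Cinf M := bump_ext (fun x => x 0 i - q 0 i).

Lemma Ck_one l : Ck l U (fun=> 1).
Proof. by apply: Ck_cst; exact: norm_ball_open. Qed.

Lemma Ck_xi l i : Ck l U (fun x => x 0 i - q 0 i).
Proof.
have Uo := @norm_ball_open R m q r.
by apply: CkD => //; [exact: Ck_coord|exact: Ck_cst].
Qed.

Lemma bumpCE p : chart_dom a p -> bumpC p = rho (chart_map a p).
Proof. by move=> ap; rewrite bump_extE ?mulr1// => l; exact: Ck_one. Qed.

Lemma coordCE i p : chart_dom a p ->
  coordC i p = rho (chart_map a p) * ((chart_map a p) 0 i - q 0 i).
Proof. by move=> ap; rewrite bump_extE// => l; exact: Ck_xi. Qed.

Lemma Dloc_bump i p : chart_dom a p ->
  Dloc a i bumpC (chart_map a p) = 'D_(e_ i) rho (chart_map a p).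
Proof.
move=> ap; apply: near_eq_derive; have ao : open (chart_cod a) := @chart_cod_open _ _ _ a.
refine (near_open_eq ao _ (chart_cod_map ap)) => x /[!inE] ax /=.
by rewrite bumpCE ?chart_codK//; exact: chart_inv_dom.
Qed.

Lemma derive_coordB i j x : 'D_(e_ i) (fun y : 'rV[R]_m => y 0 j - q 0 j) x = (i == j)%:R.
Proof.
have dj : derivable (fun y : 'rV[R]_m => y 0 j) x (e_ i).
  by apply: diff_derivable; exact: differentiable_coord.
rewrite -[LHS]/('D_(e_ i) ((fun y : 'rV[R]_m => y 0 j) - cst (q 0 j)) x).
by rewrite deriveB//= derive_cst subr0 derive_coord.
Qed.

Lemma Dloc_coord i j p : chart_dom a p ->
  Dloc a i (coordC j) (chart_map a p) = rho (chart_map a p) * (i == j)%:R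
    + ((chart_map a p) 0 j - q 0 j) * 'D_(e_ i) rho (chart_map a p).
Proof.
move=> ap; have ao : open (chart_cod a) := @chart_cod_open _ _ _ a.
set x := chart_map a p.
have -> : Dloc a i (coordC j) x = 'D_(e_ i) (rho * (fun y : 'rV[R]_m => y 0 j - q 0 j)) x.
  apply: near_eq_derive; refine (near_open_eq ao _ (chart_cod_map ap)) => y /[!inE] ay /=.
  by rewrite coordCE ?chart_codK//; exact: chart_inv_dom.
rewrite deriveM ?derive_coordB//.
  exact: Ck_derivable (Ck_bump 1 q (r / 2)) I.
apply: derivableB => //; apply: diff_derivable; exact: differentiable_coord.
Qed.

(** Hadamard's expansion holds on the disk only; multiplied by bumps it becomes an identity between
    functions on [M], to which the derivation [Y] can be applied. *)
Lemma vf_at_center (Y : vfield M) p : chart_dom a p -> chart_map a p = q ->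
  exists c : 'I_m -> R, forall f, Y f p = \sum_i c i * Dloc a i f q.
Proof.
move=> ap aq; have rq : 0 < rho q by apply: bump_gt0; rewrite divr_gt0.
have bp : bumpC p = rho q by rewrite bumpCE// aq.
(* [coordC i] is the bump times a coordinate vanishing at [p], so by Leibniz [Y] of it at [p] is
   [rho q] times the expected coefficient. *)
exists (fun i => Y (coordC i) p / rho q) => f.
have CU l : Ck l U (f \o chart_inv a) by apply: Ck_subset Ua _; exact: Ck_loc.
have [h [Ch hq hE]] := Hadamard r0 CU.
(* Cut-off Hadamard formula: every term of the sum is a product with one factor
   vanishing at p. *)
have key : bumpC * bumpC * f = cstC M (f p) * (bumpC * bumpC)
    + \sum_i coordC i * bump_ext (h i).
  apply: CinfP => p'; rewrite CinfD Cinf_sum !CinfM.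
  have [ap'|ap'] := pselect (chart_dom a p'); last first.
    rewrite [bumpC p']bump_ext0//; last exact: Ck_one.
    rewrite big1 => [|i _]; first by ring.
    by rewrite CinfM [coordC i p']bump_ext0 ?mul0r// => l; exact: Ck_xi.
  rewrite bumpCE//; set x := chart_map a p'.
  have [xq|xq] := leP (r / 2) `|x - q|.
    rewrite big1 => [|i _]; first by rewrite bump_supp ?divr_gt0//; ring.
    by rewrite CinfM coordCE// bump_supp ?divr_gt0// mul0r mul0r.
  have Ux : U x by apply: lt_trans xq _; rewrite ltr_pdivrMr// ltr_pMr// ltr1n.
  have := hE x Ux; rewrite /= -aq !chart_invK// aq => ->.
  rewrite mulrDr mulrC; congr (_ + _); rewrite mulr_sumr; apply: eq_bigr => i _.
  by rewrite -[RHS]/(coordC i p' * bump_ext (h i) p') coordCE// bump_extE//; ring.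
have := congr1 (fun F : Cinf M => Y F p) key.
rewrite vfD vfZ vf_sum !vfM !(CinfD, CinfM) Cinf_sum bp.
rewrite (eq_bigr (fun i => rho q * Dloc a i f q * Y (coordC i) p)); last first.
  move=> i _; rewrite vfM CinfD !CinfM coordCE// bump_extE// aq hq subrr mulr0 mul0r add0r.
  by rewrite mulrC.
under eq_bigr do rewrite -mulrA.
rewrite -mulr_sumr => eqY.
have {}eqY : rho q * (rho q * Y f p) = rho q * (\sum_i Dloc a i f q * Y (coordC i) p).
  (* The terms in which [Y] differentiates the bumps are the same on both sides and cancel. *)
  apply: (addIr ((rho q * Y bumpC p + Y bumpC p * rho q) * f p)).
  by rewrite mulrA eqY /=; ring.
have {}eqY := mulfI (lt0r_neq0 rq) eqY.
apply: (mulfI (lt0r_neq0 rq)); rewrite eqY mulr_sumr; apply: eq_bigr => i _.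
by field; exact: lt0r_neq0.
Qed.

End CoordinateFields.

(** * Pointwise tests: tensoriality, frames and constant functions *)

Section Consequences.
Context (R : realType) (m : nat) (M : manifold R m).
Implicit Types (f : Cinf M) (p : M) (X Y : vfield M).

Lemma vfield_scaleE (h : Cinf M) X f p : (h *: X) f p = h p * X f p.
Proof. by []. Qed.

Lemma chart_disk (a : chart R m M) p : chart_dom a p ->
  exists2 r, 0 < r & [set x | `|x - chart_map a p| < r] `<=` chart_cod a.
Proof.
move=> ap; have ao : open (chart_cod a) := @chart_cod_open _ _ _ a.
have /nbhs_ballP[r r0 br] := open_nbhs_nbhs (conj ao (chart_cod_map ap)).
by exists r => // x /= xr; apply: br; rewrite -ball_normE /= distrC.
Qed.

Lemma vf_in_chart (a : chart R m M) Y p : @atlas _ _ M a -> chart_dom a p ->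
  exists c : 'I_m -> R, forall f, Y f p = \sum_i c i * Dloc a i f (chart_map a p).
Proof.
move=> Aa ap; have [r r0 Ua] := chart_disk ap.
by apply: (vf_at_center Aa r0 Ua).
Qed.

(* The coefficients on the right vanish wherever Y does; this is what makes
   C^oo(M)-linear maps tensorial. *)
Lemma bump_vfield (a : chart R m M) (Aa : @atlas _ _ M a) q r (r0 : 0 < r)
  (Ua : [set x | `|x - q| < r] `<=` chart_cod a) Y :
  let chi := bumpC a q r in let xi := coordC a q r in
  (chi * chi * chi) *: Y =
    \sum_i (chi * Y (xi i) - xi i * Y chi) *: cfield Aa r0 Ua i.
Proof.
move=> chi xi; apply: vfieldP => f; rewrite vfield_sum; apply: CinfP => p.
rewrite Cinf_sum vfield_scaleE !CinfM.
under eq_bigr do rewrite vfield_scaleE CinfD CinfN !CinfM.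
have [ap|ap] := pselect (chart_dom a p); last first.
  have -> : chi p = 0 by apply: (bump_ext0 Aa r0 Ua) => // l; exact: Ck_one.
  by rewrite !mul0r big1// => i _; rewrite cfield0// mulr0.
have [c Yc] := vf_in_chart Y Aa ap.
set x := chart_map a p in Yc *.
rewrite Yc mulr_sumr; apply: eq_bigr => i _.
rewrite cfieldE// /chi /xi bumpCE// coordCE//.
rewrite !Yc -/x.
(* The last term, where the bump is differentiated, is the one that [xi i * Y chi] removes; what
   remains of the coefficient is [chi ^+ 2 * c i]. *)
have -> : \sum_j c j * Dloc a j (coordC a q r i) x = bumpf q (r / 2) x * c i
    + (x 0 i - q 0 i) * \sum_j c j * 'D_(delta_mx 0 j) (bumpf q (r / 2)) x.
  under eq_bigr do rewrite Dloc_coord// -/x mulrDr.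
  rewrite big_split/=; congr (_ + _).
    rewrite (bigD1 i)//= eqxx mulr1 big1 ?addr0 ?(mulrC (c i))// => j ji.
    by rewrite (negPf ji) !mulr0.
  by rewrite mulr_sumr; apply: eq_bigr => j _; ring.
have -> : \sum_j c j * Dloc a j (bumpC a q r) x
    = \sum_j c j * 'D_(delta_mx 0 j) (bumpf q (r / 2)) x.
  by apply: eq_bigr => j _; rewrite Dloc_bump.
ring.
Qed.

(** Apply [B] to the expansion [bump_vfield] of [X]: the coefficients vanish at [p], while the cube
    of the bump does not. *)
Lemma tensor_vanishes (B : vfield M -> Cinf M) X p :
  (forall f Y Z, B (f *: Y + Z) = f * B Y + B Z) -> vanishes_at p X -> B X p = 0.
Proof.
move=> Blin X0; have [a Aa ap] := @atlas_cover _ _ M p.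
have [r r0 Ua] := chart_disk ap.
have B0 : B 0 = 0.
  have := Blin 1 0 0; rewrite scaler0 addr0 mul1r => B00.
  by apply: (addIr (B 0)); rewrite add0r -B00.
have BZ f Y : B (f *: Y) = f * B Y by rewrite -[f *: Y]addr0 Blin B0 addr0.
have BD Y Z : B (Y + Z) = B Y + B Z by rewrite -[Y]scale1r Blin mul1r scale1r.
have Bsum (F : 'I_m -> vfield M) : B (\sum_i F i) = \sum_i B (F i).
  by elim/big_rec2: _ => [//|i y1 y2 _ <-]; rewrite BD.
have := congr1 (fun Z => B Z p) (bump_vfield Aa r0 Ua X).
rewrite Bsum BZ Cinf_sum big1 => [|i _]; last first.
  by rewrite BZ CinfM CinfD CinfN !CinfM !X0 !mulr0 subrr mul0r.
have chip : bumpC a (chart_map a p) r p != 0.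
  by rewrite bumpCE// gt_eqF// bump_gt0 ?divr_gt0.
by rewrite !CinfM => /eqP; rewrite !mulf_eq0 (negPf chip)/= => /eqP.
Qed.

(** Bumped coordinate fields applied to bumped coordinates give a nonzero multiple of the identity
    matrix at [p]. This brings linear algebra in dimension [m] to the point [p]. *)
Lemma frame_at p : exists E : 'I_m -> vfield M, forall c : 'I_m -> R,
  vanishes_at p (\sum_i cstC M (c i) *: E i) -> forall i, c i = 0.
Proof.
have [a Aa ap] := @atlas_cover _ _ M p.
have [r r0 Ua] := chart_disk ap.
exists (cfield Aa r0 Ua) => c cE i; set q := chart_map a p in Ua cE.
have rq : bumpf q (r / 2) q != 0 by rewrite gt_eqF// bump_gt0 ?divr_gt0.
have E j : (cstC M (c j) *: cfield Aa r0 Ua j) (coordC a q r i) p =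
    c j * (bumpf q (r / 2) q * (bumpf q (r / 2) q * (j == i)%:R)).
  by rewrite vfield_scaleE cfieldE// Dloc_coord// subrr mul0r addr0.
have := cE (coordC a q r i); rewrite vfield_sum Cinf_sum.
under eq_bigr do rewrite E.
rewrite (bigD1 i) // eqxx mulr1 big1 => [|j ji]; last by rewrite (negPf ji) !mulr0.
by rewrite /= addr0 => /eqP; rewrite !mulf_eq0 (negPf rq) !orbF => /eqP.
Qed.

(** Testing on coordinate fields kills the partial derivatives in every chart, the mean value
    theorem gives local constancy, and level sets are then open and closed. *)
Lemma vf_const f : connected [set: M] -> (forall X, X f = 0) -> forall p p', f p = f p'.
Proof.
move=> Mc f0.
have loc p : \forall p' \near p, f p' = f p.
  have [a Aa ap] := @atlas_cover _ _ M p.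
  have [r r0 Ua] := chart_disk ap; set q := chart_map a p in Ua.
  have D0 x i : chart_cod a x -> Dloc a i f x = 0.
    case=> p' ap' <-; have [r' r'0 Ua'] := chart_disk ap'.
    have := congr1 (fun h : Cinf M => h p') (f0 (cfield Aa r'0 Ua' i)).
    rewrite cfieldE// => /eqP; rewrite mulf_eq0 gt_eqF/= => [/eqP//|].
    by rewrite bump_gt0 ?divr_gt0.
  have Uo := @norm_ball_open R m q r.
  have near_p : nbhs p (chart_dom a `&` chart_map a @^-1` [set x | `|x - q| < r]).
    apply: open_nbhs_nbhs; split; first exact: chart_preimage_open.
    by split => //=; rewrite subrr normr0.
  apply: filterS near_p => p' [ap' /= p'q]; set x := chart_map a p' in p'q.
  have ao : open (chart_cod a) := @chart_cod_open _ _ _ a.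
  have seg s : `|s| <= `|1| -> chart_cod a (s *: (x - q) + q).
    rewrite normr1 => s1; apply: Ua; rewrite /= addrK normrZ.
    by apply: le_lt_trans p'q; rewrite ler_piMl.
  have [s s1] := @MVT_line R _ (f \o chart_inv a) q (x - q) 1
    (fun s s1 => diff_derivable (Ck_differentiable ao (Ck_loc Aa 1 f) (seg s s1)).1).
  rewrite (Ck_differentiable ao (Ck_loc Aa 1 f) (seg s s1)).2 big1 => [|i _].
    by rewrite mulr0 scale1r subrK /= !chart_invK// => /eqP; rewrite subr_eq0 => /eqP.
  by rewrite -[X in _ * X]/(Dloc a i f _) D0 ?mulr0//; exact: seg.
have fo c : open [set p | f p = c].
  by rewrite openE => p /= <-; exact: loc.
have foN c : open [set p | f p <> c].
  rewrite openE => p /= fp; apply: filterS (loc p) => p' /= ->; exact: fp.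
move=> p p'; have fcl : closed [set p'' | f p'' = f p'].
  by rewrite -[X in closed X]setCK; apply: open_closedC; exact: foN.
have -> // : f p = f p'; rewrite -[_ = _]/([set p'' | f p'' = f p'] p).
rewrite (Mc [set p'' | f p'' = f p'])//; first by exists p'.
  by exists [set p'' | f p'' = f p']; rewrite ?setTI.
by exists [set p'' | f p'' = f p']; rewrite ?setTI.
Qed.

End Consequences.

(** * The Lie derivative of F along the Lee field *)

Section Tensor2.
Context (R : realType) (m : nat) (M : manifold R m).
Implicit Types (X Y Z U : vfield M) (B : vfield M -> vfield M -> Cinf M).

Section Bilinear.
Variable B : vfield M -> vfield M -> Cinf M.
Hypothesis tB : tensor2 B.

Lemma tensorDl X Y Z : B (X + Y) Z = B X Z + B Y Z.
Proof. by rewrite -[X]scale1r tB.1 mul1r scale1r. Qed.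

Lemma tensorDr X Y Z : B Z (X + Y) = B Z X + B Z Y.
Proof. by rewrite -[X]scale1r tB.2 mul1r scale1r. Qed.

Lemma tensor0l Z : B 0 Z = 0.
Proof. by apply: (addrI (B 0 Z)); rewrite -tensorDl !addr0. Qed.

Lemma tensor0r Z : B Z 0 = 0.
Proof. by apply: (addrI (B Z 0)); rewrite -tensorDr !addr0. Qed.

Lemma tensorZl f X Z : B (f *: X) Z = f * B X Z.
Proof. by rewrite -[f *: X]addr0 tB.1 tensor0l addr0. Qed.

Lemma tensorZr f X Z : B Z (f *: X) = f * B Z X.
Proof. by rewrite -[f *: X]addr0 tB.2 tensor0r addr0. Qed.

Lemma tensorNl X Z : B (- X) Z = - B X Z.
Proof. by apply: (addrI (B X Z)); rewrite -tensorDl !subrr tensor0l. Qed.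

Lemma tensorNr X Z : B Z (- X) = - B Z X.
Proof. by apply: (addrI (B Z X)); rewrite -tensorDr !subrr tensor0r. Qed.

Lemma tensor_suml (I : Type) (s : seq I) (E : I -> vfield M) Z :
  B (\sum_(i <- s) E i) Z = \sum_(i <- s) B (E i) Z.
Proof. by elim: s => [|i s IH]; rewrite ?big_nil ?tensor0l// !big_cons tensorDl IH. Qed.

End Bilinear.

Lemma bracketC X Y : bracket X Y = - bracket Y X.
Proof. by apply: vfieldP => f /=; rewrite opprB. Qed.

Lemma bracketNl X Y : bracket (- X) Y = - bracket X Y.
Proof. by apply: vfieldP => f /=; rewrite vfN; ring. Qed.

Lemma bracket_jacobi X Y Z :
  bracket X (bracket Y Z) = bracket (bracket X Y) Z + bracket Y (bracket X Z).
Proof. by apply: vfieldP => f; rewrite /= -[RHS]/(_ + _) /= !vfD !vfN; ring. Qed.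

Lemma bracketZl c X Y : bracket (cstC M c *: X) Y = cstC M c *: bracket X Y.
Proof. by apply: vfieldP => f /=; rewrite vfZ; ring. Qed.

End Tensor2.

(** * Identities between [F], [J], the Lee field and the connection *)

Section LCAKTheory.
Context (R : realType) (m : nat) (M : manifold R m).
Context (g : vfield M -> vfield M -> Cinf M) (J : {linear vfield M -> vfield M})
  (F : vfield M -> vfield M -> Cinf M) (theta : {scalar vfield M}).
Hypothesis hLCAK : LCAK g J F theta.
Implicit Types (X Y Z U T : vfield M).

Lemma LCAK_tensor : tensor2 F. Proof. by case: hLCAK => -[[]]. Qed.

Lemma LCAK_alt X : F X X = 0. Proof. by case: hLCAK => -[[]]. Qed.

Lemma LCAK_closed X Y : d1 theta X Y = 0. Proof. by case: hLCAK => -[]. Qed.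

Lemma LCAK_d2 X Y Z : d2 F X Y Z = wedge12 theta F X Y Z.
Proof. by case: hLCAK => -[]. Qed.

Lemma LCAK_J X : J (J X) = - X. Proof. by case: hLCAK. Qed.

Lemma LCAK_gE X Y : g X Y = F X (J Y). Proof. by case: hLCAK. Qed.

Lemma LCAK_g_sym X Y : g X Y = g Y X. Proof. by case: hLCAK => _ _ _ []. Qed.

Lemma LCAK_g_tensor : tensor2 g. Proof. by case: hLCAK => _ _ _ []. Qed.

Lemma LCAK_g_gt0 p X : ~ vanishes_at p X -> 0 < g X X p.
Proof. by case: hLCAK => _ _ _ [_ _ +]; exact. Qed.

Local Notation tF := LCAK_tensor.
Local Notation JJ := LCAK_J.

Lemma LCAK_anti X Y : F X Y = - F Y X.
Proof.
have := LCAK_alt (X + Y); rewrite (tensorDl tF) !(tensorDr tF) !LCAK_alt add0r addr0.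
by move/eqP; rewrite addr_eq0 => /eqP.
Qed.

Lemma LCAK_FJ X Y : F X (J Y) = F Y (J X).
Proof. by rewrite -!LCAK_gE LCAK_g_sym. Qed.

Lemma LCAK_JF X Y : F (J X) Y = - F X (J Y).
Proof. by rewrite LCAK_anti LCAK_FJ. Qed.

Lemma LCAK_FJJ X Y : F (J X) (J Y) = F X Y.
Proof. by rewrite LCAK_JF JJ (tensorNr tF) opprK. Qed.

Lemma LCAK_gJJ X Y : g (J X) (J Y) = g X Y.
Proof. by rewrite !LCAK_gE LCAK_FJJ. Qed.

Section Lee.
Variable T : vfield M.
Hypothesis Tdual : forall X, g T X = theta X.

Lemma thetaE X : theta X = F T (J X).
Proof. by rewrite -Tdual LCAK_gE. Qed.

(** Cartan's formula: the contraction of [F] with [J T] is [- theta], which is closed, and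
    [theta (J T) = 0], so the contraction of [theta /\ F] with [J T] vanishes too. *)
Lemma lie_JLee X Y : lie_form2 (J T) F X Y = 0.
Proof.
have := LCAK_d2 (J T) X Y; have := LCAK_closed X Y.
rewrite /d1 /d2 /wedge12 /lie_form2 !thetaE !LCAK_JF !JJ !(tensorNr tF) LCAK_alt !vfN.
rewrite [F X (bracket _ _)]LCAK_anti [F _ (J T)]LCAK_FJ [F Y (J T)]LCAK_FJ.
move=> E1 /eqP; rewrite -subr_eq0 => /eqP E2.
match type of E1 with ?a = 0 => match type of E2 with ?b = 0 =>
  transitivity (b - a); [|by rewrite E1 E2 subrr] end end.
ring.
Qed.

Definition nijenhuis4 X Y : vfield M :=
  bracket (J X) (J Y) - bracket X Y - J (bracket (J X) Y) - J (bracket X (J Y)).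

(* theta /\ F has no (3,0)-part, hence d2 F is annihilated by the combination
   (JX, JY, T) - (X, Y, T) + (JX, Y, JT) + (X, JY, JT), in which moreover all
   derivatives of values of F cancel. *)
Lemma nijenhuis_lie X Y :
  g (nijenhuis4 X Y) (J T) = lie_form2 T F X Y - lie_form2 T F (J X) (J Y).
Proof.
have /eqP := LCAK_d2 (J X) (J Y) T; rewrite -subr_eq0 => /eqP.
have /eqP := LCAK_d2 X Y T; rewrite -subr_eq0 => /eqP.
have /eqP := LCAK_d2 (J X) Y (J T); rewrite -subr_eq0 => /eqP.
have /eqP := LCAK_d2 X (J Y) (J T); rewrite -subr_eq0 => /eqP.
have := lie_JLee (J X) Y; have := lie_JLee X (J Y).
rewrite LCAK_gE JJ /nijenhuis4 (tensorNr tF) !(tensorDl tF) !(tensorNl tF).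
rewrite /d2 /wedge12 /lie_form2 !thetaE.
rewrite (bracketC (J X) T) (bracketC (J Y) T) (bracketC X T) (bracketC Y T).
rewrite (bracketC (J X) (J T)) (bracketC (J Y) (J T)) (bracketC X (J T)) (bracketC Y (J T)).
rewrite ![F _ (bracket T _)]LCAK_anti ![F _ (bracket (J T) _)]LCAK_anti.
rewrite !(tensorNl tF) !JJ !(LCAK_FJJ, tensorNr tF, tensorNl tF) !LCAK_JF.
rewrite (LCAK_FJ X T) (LCAK_FJ Y T) (LCAK_anti X T) (LCAK_anti Y T).
rewrite !(vfN, opprK, LCAK_alt).
move=> L2 L1 E4 E3 E2 E1.
match type of E1 with ?e1 = 0 => match type of E2 with ?e2 = 0 =>
match type of E3 with ?e3 = 0 => match type of E4 with ?e4 = 0 =>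
match type of L1 with ?l1 = 0 => match type of L2 with ?l2 = 0 =>
match goal with |- ?l = ?r =>
  suff K : l - r = e1 - e2 + e3 + e4 - l1 - l2 by
    (apply/eqP; rewrite -subr_eq0 K E1 E2 E3 E4 L1 L2; apply/eqP; ring)
end end end end end end end.
ring.
Qed.

Section Connection.
Variable D : vfield M -> vfield M -> vfield M.
Hypothesis hD : levi_civita g D.

Lemma Dform1E X Y : Dform1 D theta X Y = g (D X T) Y.
Proof.
by rewrite /Dform1 -!Tdual (lc_metric hD) addrK.
Qed.

Lemma Dform1_sym X Y : Dform1 D theta X Y = Dform1 D theta Y X.
Proof.
apply/eqP; rewrite -subr_eq0; apply/eqP; rewrite -[RHS](LCAK_closed X Y) /d1 /Dform1.
by rewrite -(lc_torsionfree hD) linearB/=; ring.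
Qed.

(** The left-hand side is [L_T g], twice the symmetric part of [D theta]; the latter is symmetric
    because [theta] is closed. *)
Lemma lie_g X Y :
  T (g X Y) - g (bracket T X) Y - g X (bracket T Y) = Dform1 D theta X Y *+ 2.
Proof.
rewrite mulr2n {2}Dform1_sym !Dform1E (lc_metric hD) -!(lc_torsionfree hD).
have tg := LCAK_g_tensor.
rewrite !(tensorDl tg, tensorDr tg, tensorNl tg, tensorNr tg).
by rewrite (LCAK_g_sym X (D Y T)); ring.
Qed.

(* The right-hand side is (L_T g)(JX, Y) - (L_T g)(X, JY). *)
Lemma lie_form2_J X Y : lie_form2 T F X Y + lie_form2 T F (J X) (J Y) =
  (Dform1 D theta (J X) Y - Dform1 D theta X (J Y)) *+ 2.
Proof.
rewrite mulrnBl -!lie_g /lie_form2 !LCAK_gE !JJ !LCAK_FJJ !(tensorNr tF) vfN.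
rewrite (LCAK_JF X (bracket T (J Y))).
ring.
Qed.

Lemma Cinf_double_eq0 (f : Cinf M) : f *+ 2 = 0 -> f = 0.
Proof.
move=> f2; apply: val_inj; apply/funext => p.
have : (f *+ 2) p = 0 by rewrite f2.
by rewrite -[LHS]/(f p + f p) -mulr2n => /eqP; rewrite mulrn_eq0 => /eqP.
Qed.

(** Transfers orthogonality of the image of [N] from [J T] to [T]. *)
Lemma nijenhuisJ X Y : nijenhuis4 (J X) Y = - J (nijenhuis4 X Y).
Proof.
have JN Z : J (- Z) = - J Z by exact: linearN.
have JD Z W : J (Z + W) = J Z + J W by exact: linearD.
rewrite /nijenhuis4 JJ !bracketNl !JD !JN !JJ !opprD !opprK.
by rewrite [RHS]addrC [X in _ = _ + X]addrC [X in _ = _ + (_ + X)]addrC !addrA.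
Qed.

(** [nijenhuis_lie] and [lie_form2_J] compute the [J]-anti-invariant and [J]-invariant parts of
    [L_T F], each matching one of the two pluricanonical conditions. *)
Lemma pluricanonicalP :
  (forall X Y, lie_form2 T F X Y = 0) <->
  (forall X Y, g (nijenhuis J X Y) T = 0 /\ g (nijenhuis J X Y) (J T) = 0) /\
  (forall X Y, Dform1 D theta (J X) (J Y) = - Dform1 D theta X Y).
Proof.
have gN X Y Z : g (nijenhuis J X Y) Z = cstC M 4^-1 * g (nijenhuis4 X Y) Z.
  by rewrite (tensorZl LCAK_g_tensor).
have g4 X Y Z : cstC M 4 * g (nijenhuis J X Y) Z = g (nijenhuis4 X Y) Z.
  rewrite gN mulrA (_ : cstC M 4 * _ = 1) ?mul1r//.
  by apply: val_inj; apply/funext => p /=; rewrite -[LHS]/(4 * 4^-1) divff.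
have DN X Y : Dform1 D theta X (- Y) = - Dform1 D theta X Y.
  by rewrite !Dform1E (tensorNr LCAK_g_tensor).
split=> [L0|[N0 DJ] X Y].
  have N0 X Y : g (nijenhuis4 X Y) (J T) = 0 by rewrite nijenhuis_lie !L0 subrr.
  split=> X Y.
    split; rewrite gN ?N0 ?mulr0//.
    have : g (nijenhuis4 (J X) Y) (J T) = 0 by exact: N0.
    rewrite nijenhuisJ (tensorNl LCAK_g_tensor) LCAK_gJJ => /eqP.
    by rewrite oppr_eq0 => /eqP ->; rewrite mulr0.
  have := lie_form2_J X (J Y); rewrite !L0 addr0 => /esym/Cinf_double_eq0/eqP.
  by rewrite JJ DN opprK addr_eq0 => /eqP.
apply: Cinf_double_eq0; have := nijenhuis_lie X Y.
rewrite -g4 (N0 X Y).2 mulr0 => /esym/eqP; rewrite subr_eq0 => /eqP LJ.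
rewrite mulr2n {2}LJ lie_form2_J.
(* Anti-invariance at the pair [X], [- J Y]. *)
have -> : Dform1 D theta (J X) Y = Dform1 D theta X (J Y).
  have YE : Y = J (- J Y) by rewrite [RHS]linearN JJ opprK.
  by rewrite {1}YE DJ DN opprK.
by rewrite subrr mul0rn.
Qed.

End Connection.

(* Apply L_T to dF = theta /\ F, with L_T theta = d(theta T). *)
Lemma dtheta_wedge : (forall X Y, lie_form2 T F X Y = 0) -> forall X Y Z,
  X (theta T) * F Y Z + Y (theta T) * F Z X + Z (theta T) * F X Y = 0.
Proof.
move=> L0 X Y Z.
have L A B : T (F A B) = F (bracket T A) B + F A (bracket T B).
  by have /eqP := L0 A B; rewrite /lie_form2 -addrA -opprD subr_eq0 => /eqP.
have K (A : vfield M) : A (theta T) = T (theta A) - theta (bracket T A).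
  by have /eqP := LCAK_closed T A; rewrite /d1 subr_eq0 => /eqP <-; rewrite subKr.
have TC (A : vfield M) (f : Cinf M) : T (A f) = bracket T A f + A (T f) by rewrite /= subrK.
have E0 := congr1 T (LCAK_d2 X Y Z).
have E1 := LCAK_d2 (bracket T X) Y Z.
have E2 := LCAK_d2 X (bracket T Y) Z.
have E3 := LCAK_d2 X Y (bracket T Z).
move: E0 E1 E2 E3; rewrite /d2 /wedge12 !(vfD, vfN, vfM) !TC !L !vfD !K.
rewrite (bracket_jacobi T X Y) (bracket_jacobi T X Z) (bracket_jacobi T Y Z) !(tensorDl tF).
move=> /eqP; rewrite -subr_eq0 => /eqP E0.
move=> /eqP; rewrite -subr_eq0 => /eqP E1.
move=> /eqP; rewrite -subr_eq0 => /eqP E2.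
move=> /eqP; rewrite -subr_eq0 => /eqP E3.
(* [E0] is [T] applied to the identity, and in the other three one argument is bracketed with [T];
   hence [e1 + e2 + e3 - e0] is minus the Lie derivative of [dF - theta /\ F]. *)
match type of E0 with ?e0 = 0 =>
match type of E1 with ?e1 = 0 => match type of E2 with ?e2 = 0 =>
match type of E3 with ?e3 = 0 =>
  transitivity (e1 + e2 + e3 - e0); [|rewrite E0 E1 E2 E3; ring]
end end end end.
ring.
Qed.

End Lee.
End LCAKTheory.

(** * Adapted structures *)

Lemma exists_row_kernel (K : fieldType) (m k : nat) (A : 'M[K]_(m, k)) : (k < m)%N ->
  exists2 c : 'rV[K]_m, c != 0 & c *m A = 0.
Proof.
move=> km; have : kermx A != 0.
  by rewrite -mxrank_eq0 mxrank_ker -lt0n subn_gt0 (leq_ltn_trans (rank_leq_col A)).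
by case/rowV0Pn => c /sub_kermxP cA c0; exists c.
Qed.

Section Pluricanonical.
Context (R : realType) (m : nat) (M : manifold R m).
Context (g : vfield M -> vfield M -> Cinf M) (J : {linear vfield M -> vfield M})
  (F : vfield M -> vfield M -> Cinf M) (theta : {scalar vfield M}).
Hypothesis hLCAK : LCAK g J F theta.
Implicit Types (X Y Z U T : vfield M) (f : Cinf M) (p : M).
Local Notation tF := (LCAK_tensor hLCAK).
Local Notation tg := (LCAK_g_tensor hLCAK).
Local Notation JJ := (LCAK_J hLCAK).

(** Two linear conditions on the [m >= 3] coefficients over a frame at [p] have a nonzero
    solution. *)
Lemma orthogonal_vfield p X : (3 <= m)%N ->
  exists Y, [/\ ~ vanishes_at p Y, g Y X p = 0 & g Y (J X) p = 0].
Proof.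
move=> m3; have [E indep] := frame_at p.
pose A : 'M[R]_(m, 2) := \matrix_(i, j) (if j == 0 then g (E i) X p else g (E i) (J X) p).
have [c c0 cA] := exists_row_kernel A m3.
exists (\sum_i cstC M (c 0 i) *: E i).
have gE Z : g (\sum_i cstC M (c 0 i) *: E i) Z p = \sum_i c 0 i * g (E i) Z p.
  by rewrite (tensor_suml tg) Cinf_sum; apply: eq_bigr => i _; rewrite (tensorZl tg).
split=> [Y0||].
- by move/eqP: c0; apply; apply/rowP => i; rewrite mxE; exact: indep Y0 i.
- rewrite gE; transitivity ((c *m A) 0 0); last by rewrite cA mxE.
  by rewrite mxE; apply: eq_bigr => i _; rewrite mxE.
- rewrite gE; transitivity ((c *m A) 0 1); last by rewrite cA mxE.
  by rewrite mxE; apply: eq_bigr => i _; rewrite mxE.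
Qed.

(** Evaluate at [X], [Y], [J Y] with [Y] orthogonal to [X] and [J X] at [p]: only [X f * g Y Y]
    survives. *)
Lemma wedge_nondegenerate f : (3 <= m)%N ->
  (forall X Y Z, X f * F Y Z + Y f * F Z X + Z f * F X Y = 0) -> forall X, X f = 0.
Proof.
move=> m3 df X; apply: CinfP => p.
have [Y [Y0 YX YJX]] := orthogonal_vfield p X m3.
have := congr1 (fun h : Cinf M => h p) (df X Y (J Y)); rewrite !CinfD !CinfM.
rewrite -(LCAK_gE hLCAK) (LCAK_JF hLCAK Y X) -(LCAK_gE hLCAK Y X) CinfN YX oppr0 mulr0 addr0.
rewrite -(LCAK_FJJ hLCAK X Y) -(LCAK_gE hLCAK) (LCAK_g_sym hLCAK) YJX mulr0 addr0 Cinf0.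
move/eqP; rewrite mulf_eq0 => /orP[/eqP //|].
by rewrite gt_eqF//; exact: (LCAK_g_gt0 hLCAK Y0).
Qed.

(** Moves the rescaling from the form to the field, so that the rest can be done with the original
    [F]. *)
Lemma scale_lie_form2 c U X Y :
  lie_form2 (cstC M c *: U) F X Y = lie_form2 U (scale_form2 c F) X Y.
Proof.
rewrite /lie_form2 /scale_form2 !bracketZl (tensorZl tF) (tensorZr tF) vfZ.
by rewrite -[X in X - _ - _]/(cstC M c * U (F X Y)).
Qed.

Lemma cstCM (a b : R) : cstC M a * cstC M b = cstC M (a * b).
Proof. exact: CinfP. Qed.

Lemma cstC1 : cstC M 1 = 1.
Proof. exact: CinfP. Qed.

Lemma J_vanishes p X : vanishes_at p X -> vanishes_at p (J X).
Proof.
move=> X0 f; apply: (tensor_vanishes (B := fun Z => J Z f)) X0 => h Y Z.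
by rewrite linearP.
Qed.

Section Lee.
Variable T : vfield M.
Hypothesis Tdual : forall X, g T X = theta X.
Hypothesis T_lie : forall X Y, lie_form2 T F X Y = 0.

Lemma lee_norm_const : (3 <= m)%N -> connected [set: M] ->
  forall p p', theta T p = theta T p'.
Proof.
move=> m3 Mc; apply: vf_const => //.
exact: (wedge_nondegenerate m3 (dtheta_wedge hLCAK T_lie)).
Qed.

(** As [theta \o J] is minus the contraction of [F] with [T], Cartan's formula and [L_T F = 0] make
    its differential the contraction of [theta /\ F] with [T]. *)
Lemma d_theta_J X Y : d1 (fun Z => theta (J Z)) X Y =
  theta T * F X Y + theta X * theta (J Y) - theta Y * theta (J X).
Proof.
have := LCAK_d2 hLCAK T X Y; have := T_lie X Y.
rewrite /d2 /wedge12 /lie_form2 /d1 !(thetaE hLCAK Tdual) !JJ !(tensorNr tF).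
rewrite (LCAK_anti hLCAK Y T) (LCAK_anti hLCAK X (bracket T Y)).
rewrite (LCAK_anti hLCAK (bracket X Y) T) !vfN.
move=> E1 /eqP; rewrite -subr_eq0 => /eqP E2.
match type of E1 with ?e1 = 0 => match type of E2 with ?e2 = 0 =>
match goal with |- ?l = ?r =>
  suff K : l - r = e2 - e1 by
    (apply/eqP; rewrite -subr_eq0 K E1 E2; apply/eqP; ring) end end end.
ring.
Qed.

Lemma adapted_of_lie c : 0 < c -> theta T = cstC M c ->
  first_kind (scale_form2 c F) theta /\ adapted J (scale_form2 c F) theta.
Proof.
move=> c0 Tc; have cV : cstC M c * cstC M c^-1 = 1 by rewrite cstCM divff ?cstC1// gt_eqF.
pose U := cstC M c^-1 *: T.
have TU : cstC M c *: U = T by rewrite scalerA cV scale1r.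
have fkU : first_kind_field (scale_form2 c F) theta U.
  split=> [X Y|]; first by rewrite -scale_lie_form2 TU.
  by rewrite linearZ/= Tc -[LHS]/(cstC M c^-1 * cstC M c) mulrC cV.
split; first by exists U.
have etaE X : - scale_form2 c F U X = theta (J X).
  by rewrite /scale_form2 (tensorZl tF) mulrA cV mul1r (thetaE hLCAK Tdual) JJ (tensorNr tF).
(* [V = - J U] is forced by [J V = U]. *)
exists U, (- J U); split=> // [X|].
  rewrite /scale_form2 (tensorNl tF) linearZ/= (tensorZl tF) mulrN mulrA cV mul1r.
  by rewrite (LCAK_JF hLCAK) opprK (thetaE hLCAK Tdual).
set eta := fun X => _; have {}etaE : eta = fun X => theta (J X) by apply/funext.
have thJJ X : theta (J (J X)) = - theta X by rewrite JJ linearN.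
(* On [H] the products of [theta] and [eta] drop out of [d_theta_J], leaving [c] times the metric:
   both symmetry and positivity follow. *)
have dH p X Y : in_H theta eta p X -> in_H theta eta p Y -> d1 eta X (J Y) p = c * g X Y p.
  rewrite /in_H etaE => -[X1 X2] [Y1 Y2].
  rewrite d_theta_J -(LCAK_gE hLCAK) thJJ !CinfD !CinfN !CinfM CinfN X1 X2 Tc.
  by rewrite -[cstC M c p]/c; ring.
split.
- split=> p X.
    by rewrite /in_H etaE thJJ => -[X1 X2]; split => //; rewrite CinfN X1 oppr0.
  (* Since [J U = - V] and [J V = U], the vector [a U + b V] is sent to [b U - a V]. *)
  case=> a [b Xab]; exists b, (- a); have := J_vanishes Xab.
  suff -> : J (X - cstC M a *: U - cstC M b *: - J U)
     = J X - cstC M b *: U - cstC M (- a) *: - J U by [].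
  have cN : cstC M (- a) = - cstC M a by exact: CinfP.
  rewrite !linearB/= !linearZ/= linearN JJ opprK cN scaleNr scalerN opprK.
  by rewrite addrAC [cstC M a *: - _]scalerN.
- by move=> X; rewrite etaE.
- by move=> p X Y HX HY; rewrite !dH// (LCAK_g_sym hLCAK).
- by move=> p X HX X0; rewrite dH// mulr_gt0//; exact: (LCAK_g_gt0 hLCAK X0).
Qed.

End Lee.

Lemma lie_of_adapted c : adapted J (scale_form2 c F) theta ->
  exists U, theta U = 1 /\ let T := cstC M c *: U in
    (forall X, g T X = theta X) /\ (forall X Y, lie_form2 T F X Y = 0).
Proof.
case=> U [V [[LU thU] _ [_ thJ _ _]]]; exists U; split => //; split=> [X|X Y].
  rewrite (tensorZl tg) (LCAK_gE hLCAK).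
  (* At [J X] the condition [J theta = - eta] reads [theta X = c F(U, J X)], which is [g(c U, X)]:
     the field [c U] is the Lee field. *)
  have := thJ (J X); rewrite JJ linearN opprK -/(theta X) => ->.
  by rewrite opprK.
by rewrite scale_lie_form2.
Qed.

End Pluricanonical.

Unset Implicit Arguments.
Set Strict Implicit.

Theorem theorem14 (R : realType) (n : nat) (hn : (2 <= n)%N)
  (M : manifold R n.*2) (M0 : [set: M] !=set0) (Mconn : connected [set: M])
  (g : vfield M -> vfield M -> Cinf M)
  (J : {linear vfield M -> vfield M})
  (F : vfield M -> vfield M -> Cinf M)
  (theta : {scalar vfield M})
  (hLCAK : LCAK g J F theta)
  (D : vfield M -> vfield M -> vfield M) (hD : levi_civita g D) :
  (exists2 c : R, 0 < c &
     first_kind (scale_form2 c F) theta /\ adapted J (scale_form2 c F) theta)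
  <->
  (pluricanonical g J theta D /\ exists X : vfield M, theta X <> 0).
Proof.
split=> [[c c0 [_ /(lie_of_adapted hLCAK)[U [thU [Tdual T_lie]]]]]|].
  have [N0 DJ] := (pluricanonicalP hLCAK Tdual hD).1 T_lie.
  split; first by exists (cstC M c *: U).
  (* A point of [M] is needed to tell the functions [1] and [0] apart. *)
  exists U; rewrite thU; case: M0 => p _ /(congr1 (fun f : Cinf M => f p)) /eqP.
  by rewrite Cinf1 Cinf0 oner_eq0.
case=> -[T [Tdual N0 DJ]] [X thX].
have T_lie := (pluricanonicalP hLCAK Tdual hD).2 (conj N0 DJ).
have m3 : (3 <= n.*2)%N by apply: (@leq_trans 2.*2); rewrite ?leq_double.
have const := lee_norm_const hLCAK T_lie m3 Mconn.
have [p Tp] : exists p, ~ vanishes_at p T.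
  apply: contrapT => /forallNP T0; apply: thX; rewrite -Tdual.
  suff -> : T = 0 by rewrite (tensor0l (LCAK_g_tensor hLCAK)).
  by apply: vfieldP => f; apply: CinfP => p; apply: contrapT => Tf; apply: (T0 p); exact.
(* The rescaling constant is the constant value of [|T|^2], positive because [T] does not vanish at
   [p]. *)
exists (theta T p); first by rewrite -Tdual; exact: (LCAK_g_gt0 hLCAK Tp).
apply: (adapted_of_lie hLCAK Tdual T_lie).
  by rewrite -Tdual; exact: (LCAK_g_gt0 hLCAK Tp).
by apply: CinfP => p'; exact: const.
Qed.
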